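(* Assume the setting in the context. Then for every $\lambda\in\mathbb{R}^d$, for $\mathbb{P}$-almost every $\omega$, $$\limsup_{n\to\infty}\frac1n\log E^{P_\omega}\left[\mathrm{e}^{\langle\lambda,X_n\rangle}\right]\le\Lambda(\lambda).$$
   Context: Let $d\ge 1$ and $U=\{e\in\mathbb{Z}^d: |e|=1\}$ ($\ell_1$ norm $|x|=\sum|x_i|$). Let $(\Omega,\mathcal{F},\mathbb{P})$ be a probability space and $\{T_e\}_{e\in U}$ commuting $\mathbb{P}$-measure-preserving transformations with $T_{-e}=T_e^{-1}$, forming an ergodic family (every event invariant under all $T_e$ has probability $0$ or $1$); $T_x=T_{e_1}^{x_1}\cdots T_{e_d}^{x_d}$. Let $p:\Omega\times U\to[0,1]$ be measurable with $\sum_{e}p(\omega,e)=1$. For fixed $\omega$, $P_\omega$ is the law of the random walk $(X_n)$ on $\mathbb{Z}^d$ with $X_0=0$ and $P_\omega(X_{n+1}=X_n+e\mid X_0,\dots,X_n)=p(T_{X_n}\omega,e)$. A function $F:\Omega\times U\to\mathbb{R}$ is in class $\mathcal{K}$ if: (i) there is $\alpha>0$ with $\mathbb{E}[|F(\cdot,e)|^{d+\alpha}]<\infty$ for every $e$; (ii) $\mathbb{E}[F(\cdot,e)]=0$ for every $e$; (iii) ($\mathbb{P}$-a.s.) for every finite sequence $x_0,\dots,x_n\in\mathbb{Z}^d$ with $x_{i+1}-x_i\in U$ and $x_0=x_n$, $\sum_{i=0}^{n-1}F(T_{x_i}\omega,x_{i+1}-x_i)=0$. $$\Lambda(\lambda)=\inf_{F\in\mathcal{K}}\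 \operatorname*{ess\,sup}_{\omega}\ \log\sum_{e\in U}p(\omega,e)\,\mathrm{e}^{\langle\lambda,e\rangle+F(\omega,e)}.$$ *)

(* Defs.v *)
From HB Require Import structures.
From mathcomp Require Import all_boot all_order all_algebra.
From mathcomp Require Import all_classical all_reals all_analysis.
From mathcomp Require Import ess_sup_inf.
Set Implicit Arguments. Unset Strict Implicit. Unset Printing Implicit Defensive.
Import Order.TTheory GRing.Theory Num.Theory.
Import numFieldNormedType.Exports.
Local Open Scope classical_set_scope.
Local Open Scope ring_scope.

(* Z^d is 'rV[int]_d.  The set U = {e in Z^d : |e|_1 = 1} is enumerated by
   'I_d * bool : (i, true) |-> +e_i, (i, false) |-> -e_i. *)
Definition dir (d : nat) (k : 'I_d * bool) : 'rV[int]_d :=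
  (if k.2 then 1 else -1) *: delta_mx 0 k.1.

Definition dotZ (R : realType) (d : nat) (lam : 'rV[R]_d) (x : 'rV[int]_d) : R :=
  \sum_i lam 0 i * (x 0 i)%:~R.

Definition powT (Om : Type) (d : nat) (T Tinv : 'I_d -> Om -> Om)
  (i : 'I_d) (z : int) (w : Om) : Om :=
  match z with
  | Posz n => iter n (T i) w
  | Negz n => iter n.+1 (Tinv i) w
  end.

Definition shift (Om : Type) (d : nat) (T Tinv : 'I_d -> Om -> Om)
  (x : 'rV[int]_d) (w : Om) : Om :=
  foldr (fun i w' => powT T Tinv i (x 0 i) w') w (enum 'I_d).

Definition pos (d : nat) (s : seq ('I_d * bool)) (j : nat) : 'rV[int]_d :=
  \sum_(k <- take j s) dir k.

(* E^{P_omega}[exp <lam, X_n>]: expectation under the quenched law of the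
   walk, written as the sum over all n-step paths of their probability. *)
Definition quenched_mgf (R : realType) (Om : Type) (d : nat)
  (T Tinv : 'I_d -> Om -> Om) (p : Om -> 'I_d * bool -> R)
  (lam : 'rV[R]_d) (n : nat) (w : Om) : R :=
  \sum_(s : n.-tuple ('I_d * bool))
     (\prod_(j < n) p (shift T Tinv (pos s j) w) (tnth s j))
     * expR (dotZ lam (pos s n)).

Definition classK (R : realType) (dsp : measure_display) (Om : measurableType dsp)
  (P : probability Om R) (d : nat) (T Tinv : 'I_d -> Om -> Om)
  (F : Om -> 'I_d * bool -> R) : Prop :=
  [/\ (exists2 a : R, 0 < a &
        forall k, measurable_fun setT (fun w => F w k) /\
          (\int[P]_w ((`|F w k| `^ (d%:R + a))%:E) < +oo)%E),
      (forall k, (\int[P]_w (F w k)%:E = 0)%E) &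
      {ae P, forall w, forall (x0 : 'rV[int]_d) (s : seq ('I_d * bool)),
          pos s (size s) = 0 ->
          \sum_(j < size s) F (shift T Tinv (x0 + pos s j) w) (tnth (in_tuple s) j)
            = 0}].

Definition Lambda (R : realType) (dsp : measure_display) (Om : measurableType dsp)
  (P : probability Om R) (d : nat) (T Tinv : 'I_d -> Om -> Om)
  (p : Om -> 'I_d * bool -> R) (lam : 'rV[R]_d) : \bar R :=
  ereal_inf [set ess_sup P (fun w =>
      (ln (\sum_k p w k * expR (dotZ lam (dir k) + F w k)))%:E)
    | F in [set F | classK P T Tinv F]].

(* Main.v *)
(* A function F of class K is the gradient of a potential W on Z^d along the
   orbit of w.  Multiplying the walk's weights by exp (F) gives
   E[exp (<lam,X_n> + W (X_n) - W (0))] <= exp (n y) as soon as y exceeds the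
   essential supremum attached to F, so it is enough that W (x) = o(|x|)
   uniformly, almost surely.  To see this, compare W with its averages W_N over
   cubes of side N.  The difference is bounded by increments of W near x, which
   are o(|x|) since F is in L^q with q > d.  The gradient of W_N is the average
   of F over cubes of side N, which is small in L^q for large N (mean ergodic
   theorem); by the maximal inequality its q-th power then has small averages
   over all large cubes off a small event, and Morrey's inequality turns this
   into a bound on W_N, uniform over boxes. *)
Require Import Defs.
From HB Require Import structures.
From mathcomp Require Import all_boot all_order all_algebra.
From mathcomp Require Import all_classical all_reals all_analysis.
From mathcomp Require Import ess_sup_inf measurable_realfun.
From mathcomp Require Import zify ring lra.
Set Implicit Arguments. Unset Strict Implicit. Unset Printing Implicit Defensive.
Import Order.TTheory GRing.Theory Num.Theory.
Import numFieldNormedType.Exports.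
Local Open Scope classical_set_scope.
Local Open Scope ring_scope.


(** * Covering and averages over lattice cubes *)

(** Morrey's inequality for [W] itself only yields [W x = O(|x|)], because the [q]-th moment of its
    gradient is a fixed number. The zero mean of [F] has to make this number small, and it acts only
    after averaging; this is why [W_N] appears. What Morrey's inequality consumes is smallness at
    every dyadic scale for one fixed [N]: the mean ergodic theorem makes the moment of the averaged
    gradient small, and the maximal inequality makes this uniform in the scale, off an event of
    small probability. The side [N] then depends on [w]: there are sides whose bad events have
    probability tending to 0, so almost every [w] avoids one of these events. The hypothesis [q > d]
    enters twice: in Morrey's sum over scales, and in the union bound that makes single increments
    [o(|x|)]. The mean ergodic theorem is proved for bounded functions, from cube averages of nearly
    minimal L^2 norm, and carried to L^q by truncation. *)

Section Vitali.
Context (R : realType) (I V : finType) (rad : I -> nat) (Q : I -> pred V)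
  (wt : I -> R) (f : V -> R) (C t : R).
Hypotheses (t_ge0 : 0 <= t) (f_ge0 : forall v, 0 <= f v)
  (C_ge0 : 0 <= C) (Q_neq0 : forall x, exists v, Q x v).

(* Greedy selection: the set of largest radius accounts for every set that it
   meets, and the remaining sets are disjoint from it. *)
Lemma vitali_count (D : {pred I}) :
  (forall x, x \in D ->
     #|[pred z in D | (rad z <= rad x)%N && [exists v, Q z v && Q x v]]|%:R
       <= C * wt x) ->
  (forall x, x \in D -> t * wt x <= \sum_(v | Q x v) f v) ->
  t * #|D|%:R <= C * \sum_(v | [exists x in D, Q x v]) f v.
Proof.
have [n] := ubnP #|D|; elim: n => // n IH in D *.
rewrite ltnS => leD near heavy.
have [/card0_eq D0|] := posnP #|D|.
  rewrite eq_card0// mulr0 mulr_ge0// sumr_ge0//.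
case/card_gt0P => x0 x0D; case: (arg_maxnP rad x0D) => x xD xmax.
pose N := [pred z in D | [exists v, Q z v && Q x v]].
pose D' := [pred z in D | z \notin N].
have NQ : #|N|%:R <= C * wt x.
  apply: le_trans (near x xD); rewrite ler_nat subset_leq_card//.
  apply/fintype.subsetP => z; rewrite !inE => /andP[zD ->].
  by rewrite zD; have /= -> := xmax z zD.
have tN : t * #|N|%:R <= C * \sum_(v | Q x v) f v.
  apply: le_trans (ler_wpM2l t_ge0 NQ) _.
  by rewrite mulrCA ler_wpM2l// heavy.
have xN : x \in N.
  have [v Qv] := Q_neq0 x.
  by rewrite inE; apply/andP; split => //; apply/existsP; exists v; rewrite Qv.
have cardE : #|D| = (#|N| + #|D'|)%N.
  rewrite -(cardID N D); congr (_ + _)%N; apply: eq_card => z; rewrite !inE.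
    by case: (z \in D).
  by rewrite andbC.
have D'lt : (#|D'| < n)%N.
  have : (0 < #|N|)%N by apply/card_gt0P; exists x.
  by move: leD; rewrite cardE; lia.
have D'D z : z \in D' -> z \in D by rewrite inE => /andP[].
have {}IH : t * #|D'|%:R <= C * \sum_(v | [exists y in D', Q y v]) f v.
  apply: IH => // y yD'; last exact/heavy/D'D.
  apply: le_trans (near y (D'D y yD')).
  rewrite ler_nat subset_leq_card//; apply/fintype.subsetP => z.
  by rewrite !inE => /andP[/andP[-> _] ->].
rewrite cardE natrD mulrDr (le_trans (lerD tN IH))// -mulrDr ler_wpM2l//.
rewrite [leRHS](bigID (Q x))/=; apply: lerD.
  rewrite [leRHS](eq_bigl (Q x)) // => v; apply/andP/idP => [[]//|Qv].
  by split => //; apply/exists_inP; exists x.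
rewrite [leRHS](bigID (fun v => [exists y in D', Q y v]))/=.
rewrite [X in _ <= X + _](eq_bigl (fun v => [exists y in D', Q y v])).
  by rewrite lerDl sumr_ge0.
move=> v; apply/andP/idP => [[]//|/existsP[y /andP[yD' Qyv]]]; split.
  apply/andP; split; first by apply/exists_inP; exists y => //; exact: D'D.
  apply/negP => Qxv; move: yD'; rewrite !inE negb_and => /andP[yD].
  by rewrite yD/= => /existsP; apply; exists v; rewrite Qyv.
by apply/exists_inP; exists y.
Qed.
End Vitali.

Section Averages.
Context (R : realType).

(** Below the level [s] the first term suffices; above it [u / s >= 1] is at most its own [q]-th
    power. The right-hand side is affine in the power of [u], so it can be averaged. *)
Lemma powR_young (q s u : R) : 1 <= q -> 0 < s -> 0 <= u ->
  u <= s + s * (u `^ q / s `^ q).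
Proof.
move=> q1 s0 u0; have [us|su] := leP u s.
  by rewrite (le_trans us)// lerDl mulr_ge0// ?(ltW s0)// divr_ge0// powR_ge0.
rewrite -[leLHS]add0r lerD ?(ltW s0)// -powRN -{1}(mulfVK (lt0r_neq0 s0) u).
rewrite mulrC ler_wpM2l ?(ltW s0)// powRN.
have -> : u `^ q / s `^ q = (u / s) `^ q.
  by rewrite powRM ?invr_ge0 ?(ltW s0)// -(powR_inv1 (ltW s0)) powRAC powR_inv1// powR_ge0.
by rewrite le1r_powR// ler_pdivlMr// mul1r ltW.
Qed.

(* Jensen's inequality up to a constant, obtained by averaging Young's
   inequality at the level [s = (avg f^q)^(1/q)]. *)
Lemma sum_powR_le (I : finType) (f : I -> R) (q : R) : 1 <= q ->
  (forall i, 0 <= f i) -> (0 < #|I|)%N ->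
  ((\sum_i f i) / #|I|%:R) `^ q
    <= 2 `^ q * ((\sum_i f i `^ q) / #|I|%:R).
Proof.
move=> q1 f0 I0; have q0 : q != 0 by rewrite gt_eqF// (lt_le_trans ltr01).
have q_ge0 : 0 <= q by exact: le_trans q1.
have I0R : 0 < #|I|%:R :> R by rewrite ltr0n.
set A := (\sum_i f i `^ q) / _.
have A0 : 0 <= A by rewrite divr_ge0// sumr_ge0// => i _; exact: powR_ge0.
(* The level [s] chosen below would vanish here; in this case every [f i] is 0. *)
have [A_eq0|A_neq0] := eqVneq A 0.
  have : \sum_i f i `^ q = 0.
    by move/eqP: A_eq0; rewrite mulf_eq0 invr_eq0 (gt_eqF I0R) orbF => /eqP.
  move/eqP; rewrite psumr_eq0; last by move=> i _; exact: powR_ge0.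
  move=> /allP fq0; rewrite big1 ?mul0r ?powR0// ?A_eq0 ?mulr0// => i _.
  have := fq0 i; rewrite mem_index_enum => /(_ isT)/=.
  by rewrite powR_eq0 => /andP[/eqP].
have {A0 A_neq0} A0 : 0 < A by rewrite lt0r A_neq0.
pose s := A `^ q^-1; have s0 : 0 < s by exact: powR_gt0.
have sq : s `^ q = A by rewrite -powRrM mulVf// powRr1// ltW.
have avg_le : (\sum_i f i) / #|I|%:R <= 2 * s.
  rewrite ler_pdivrMr//.
  have -> : 2 * s * #|I|%:R = \sum_i (s + s * (f i `^ q / s `^ q)).
    rewrite big_split/= sumr_const -mulr_natr -mulr_sumr -mulr_suml sq.
    have -> : \sum_i f i `^ q = A * #|I|%:R by rewrite divfK// gt_eqF.
    by field; rewrite gt_eqF.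
  by apply: ler_sum => i _; exact: powR_young.
rewrite -sq -powRM ?(ltW s0)// ge0_ler_powR// nnegrE ?mulr_ge0 ?(ltW s0)//.
by rewrite sumr_ge0.
Qed.
End Averages.

(** * Cube averages on the lattice and a discrete Morrey inequality *)

Section Lattice.
Context (R : realType) (d : nat).
Local Notation Zd := 'rV[int]_d.
Implicit Types (f : Zd -> R) (x y z : Zd) (n m : nat).

Definition vec n (v : {ffun 'I_d -> 'I_n}) : Zd := \row_i (v i : nat)%:Z.

(** The point [x] is the lowest corner of the cube, not its centre. *)
Definition cavg n f x : R :=
  (\sum_(v : {ffun 'I_d -> 'I_n}) f (x + vec v)) / (n ^ d)%:R.

Definition unitv (i : 'I_d) : Zd := delta_mx 0 i.

Lemma card_cube n : #|{ffun 'I_d -> 'I_n}| = (n ^ d)%N.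
Proof. by rewrite card_ffun !card_ord. Qed.

Lemma unitvE i j : unitv i 0 j = (j == i)%:Z.
Proof. by rewrite mxE eqxx/= natz. Qed.

Lemma expn_cube_gt0 n : (0 < n)%N -> 0 < (n ^ d)%:R :> R.
Proof. by move=> n0; rewrite ltr0n expn_gt0 n0. Qed.

Lemma cavgC n m f x : cavg n (cavg m f) x = cavg m (cavg n f) x.
Proof.
rewrite /cavg -!mulr_suml -!mulrA [_^-1 * _^-1]mulrC; congr (_ * _).
rewrite exchange_big/=; apply: eq_bigr => u _; apply: eq_bigr => v _.
by rewrite addrAC.
Qed.

Lemma cavg_shift n f x y : cavg n (fun z => f (z + y)) x = cavg n f (x + y).
Proof.
by rewrite /cavg; congr (_ / _); apply: eq_bigr => v _; rewrite addrAC.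
Qed.

Lemma cavgB n f g x :
  cavg n (fun z => f z - g z) x = cavg n f x - cavg n g x.
Proof. by rewrite /cavg sumrB mulrBl. Qed.

Lemma cavg_cst n c x : (0 < n)%N -> cavg n (fun=> c) x = c.
Proof.
move=> n0; rewrite /cavg sumr_const card_cube -[c *+ _]mulr_natr mulfK//.
by rewrite gt_eqF// expn_cube_gt0.
Qed.

Lemma cavg_le n f g x : (forall v : {ffun 'I_d -> 'I_n},
  f (x + vec v) <= g (x + vec v)) -> cavg n f x <= cavg n g x.
Proof.
by move=> fg; rewrite /cavg ler_wpM2r ?invr_ge0 ?ler0n//; exact: ler_sum.
Qed.

Lemma normr_cavg_le n f x : `|cavg n f x| <= cavg n (fun z => `|f z|) x.
Proof.
rewrite /cavg normrM [X in _ * X]ger0_norm ?invr_ge0 ?ler0n//.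
by rewrite ler_wpM2r ?invr_ge0 ?ler0n// ler_norm_sum.
Qed.

Lemma cavg_dist n f x c M : (0 < n)%N ->
  (forall v : {ffun 'I_d -> 'I_n}, `|f (x + vec v) - c| <= M) ->
  `|cavg n f x - c| <= M.
Proof.
move=> n0 fM; rewrite -{1}(cavg_cst c x n0) -cavgB.
rewrite (le_trans (normr_cavg_le _ _ _))// -[leRHS](cavg_cst M x n0).
exact: cavg_le.
Qed.

Lemma cavg_powR_le n f x (q : R) : 1 <= q -> (0 < n)%N ->
  `|cavg n f x| `^ q <= 2 `^ q * cavg n (fun z => `|f z| `^ q) x.
Proof.
move=> q1 n0; have q0 : 0 <= q by exact: le_trans q1.
have card0 : (0 < #|{ffun 'I_d -> 'I_n}|)%N by rewrite card_cube expn_gt0 n0.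
have := @sum_powR_le R _ (fun v : {ffun 'I_d -> 'I_n} => `|f (x + vec v)|) q q1
  (fun _ => normr_ge0 _) card0.
rewrite card_cube; apply: le_trans; rewrite ge0_ler_powR ?nnegrE//.
  by rewrite divr_ge0// sumr_ge0.
exact: normr_cavg_le.
Qed.

Lemma cube_sum_le f x y n m : (0 < m)%N -> (forall z, 0 <= f z) ->
  (forall i, y 0 i <= x 0 i /\ x 0 i + n%:Z <= y 0 i + m%:Z) ->
  \sum_(v : {ffun 'I_d -> 'I_n}) f (x + vec v)
    <= \sum_(v : {ffun 'I_d -> 'I_m}) f (y + vec v).
Proof.
case: m => // m _ f0 xy.
(* [h] gives the coordinates of a point of the small cube inside the large one; by the inclusion
   hypothesis neither the absolute value nor [inord] alters the number. *)
pose h (v : {ffun 'I_d -> 'I_n}) : {ffun 'I_d -> 'I_m.+1} :=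
  [ffun i => inord `|(x 0%R i - y 0%R i + (v i)%:Z)%R|%N].
have hE v i : (h v i)%:Z = x 0 i - y 0 i + (v i)%:Z.
  rewrite ffunE inordK; have := xy i; have := ltn_ord (v i); lia.
have h_inj : injective h.
  move=> u v uv; apply/ffunP => i; apply/val_inj => /=.
  by have := hE u i; rewrite uv hE => /addrI[].
have fE v : f (x + vec v) = f (y + vec (h v)).
  congr f; apply/rowP => i; rewrite !mxE hE; ring.
rewrite (eq_bigr _ (fun v _ => fE v)).
have -> : \sum_v f (y + vec (h v)) =
    \sum_(u in h @: {: {ffun 'I_d -> 'I_n}}) f (y + vec u).
  by rewrite big_imset//; apply: in2W.
rewrite [leRHS](bigID (fun u => u \in h @: {: {ffun 'I_d -> 'I_n}}))/=.
by rewrite lerDl sumr_ge0.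
Qed.

(** Lowering coordinates one unit at a time joins each point to the corner [lo] in at most [d * L]
    steps inside the box. The detour through [lo] gives the factor 2. *)
Lemma lip_box (U : Zd -> R) (lo : Zd) (L : nat) (M : R) x y : 0 <= M ->
  (forall z i, (forall j, lo 0 j <= z 0 j <= lo 0 j + L%:Z) ->
     `|U (z + unitv i) - U z| <= M) ->
  (forall j, lo 0 j <= x 0 j <= lo 0 j + L%:Z) ->
  (forall j, lo 0 j <= y 0 j <= lo 0 j + L%:Z) ->
  `|U x - U y| <= (2 * d * L)%:R * M.
Proof.
move=> M0 UM xB yB.
suff to_lo z : (forall j, lo 0 j <= z 0 j <= lo 0 j + L%:Z) ->
    `|U z - U lo| <= (d * L)%:R * M.
  rewrite (_ : U x - U y = U x - U lo - (U y - U lo)); last by ring.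
  have -> : (2 * d * L)%:R * M = (d * L)%:R * M + (d * L)%:R * M.
    by rewrite -mulnA natrM; ring.
  by rewrite (le_trans (ler_normB _ _))// lerD// to_lo.
move=> zB; pose N z := (\sum_j `|(z 0%R j - lo 0%R j)%R|%N)%N.
have N_le : (N z <= d * L)%N.
  rewrite /N -[X in (X * _)%N]card_ord -sum_nat_const; apply: leq_sum => j _.
  by have := zB j; lia.
apply: (@le_trans _ _ ((N z)%:R * M)); last by rewrite ler_wpM2r// ler_nat.
move: zB {N_le}; have [k] := ubnP (N z).
elim: k => // k IH in z * => Nk zB.
have [i zi|zlo] := pickP (fun i => z 0 i != lo 0 i); last first.
  have -> : z = lo by apply/rowP => j; have := zlo j; move/eqP.
  by rewrite subrr normr0 mulr_ge0.
have zE : z = z - unitv i + unitv i by rewrite subrK.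
have z'B j : lo 0 j <= (z - unitv i) 0 j <= lo 0 j + L%:Z.
  rewrite !mxE eqxx/= natz; have := zB j; case: eqVneq => [->|_] /=; lia.
have NE : N z = (N (z - unitv i)).+1.
  rewrite /N (bigD1 i)// [in RHS](bigD1 i)//= -addSn; congr (_ + _)%N.
    by rewrite !mxE !eqxx/=; have := zB i; lia.
  apply: eq_bigr => j ji; rewrite !mxE eqxx/= (negbTE ji)/=; lia.
have lt' : (N (z - unitv i)%R < k)%N by rewrite -ltnS -NE.
rewrite NE -natr1 mulrDl mul1r.
have := IH _ lt' z'B; have := UM _ i z'B; rewrite -zE => h1 h2.
rewrite (_ : U z - U lo = U (z - unitv i) - U lo + (U z - U (z - unitv i))); last by ring.
by rewrite (le_trans (ler_normD _ _))// lerD.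
Qed.

Lemma cavg_grad m (U : Zd -> R) z i :
  cavg m U (z + unitv i) - cavg m U z = cavg m (fun y => U (y + unitv i) - U y) z.
Proof. by rewrite cavgB cavg_shift. Qed.

Lemma cavg_near N (U : Zd -> R) x M : (0 < N)%N -> 0 <= M ->
  (forall z i, (forall j, x 0 j <= z 0 j <= x 0 j + N%:Z) ->
     `|U (z + unitv i) - U z| <= M) ->
  `|cavg N U x - U x| <= (2 * d * N)%:R * M.
Proof.
move=> N0 M0 UM; apply: cavg_dist => // v; apply: (lip_box (lo := x)) => // j.
  rewrite !mxE lerDl lerD2l ; exact: ltnW (ltn_ord _).
lia.
Qed.

(** The cube of side [2 * n] at [corner n] is [[-n,n)^d]; hence sides [8 * 2 ^ k] go with
    [corner (4 * 2 ^ k)]. *)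
Definition corner n : Zd := \row_(_ < d) (- n%:Z).

(** [b] bounds an unnormalised L^q norm of the gradient over [[-4n,4n)^d]. A subcube with [m ^ d]
    points inherits the bound on the sum, so the power mean inequality gains [m^(-d/q)]; the factor
    2 is the loss in [cavg_powR_le]. *)
Lemma grad_cavg_le (U : Zd -> R) (q b : R) m n z i :
  1 <= q -> (0 < m)%N -> 0 <= b ->
  (forall i, \sum_(v : {ffun 'I_d -> 'I_(8 * n)})
     `|U (corner (4 * n) + vec v + unitv i) - U (corner (4 * n) + vec v)| `^ q
       <= b `^ q) ->
  (forall j, - (4 * n)%:Z <= z 0 j /\ z 0 j + m%:Z <= (4 * n)%:Z) ->
  `|cavg m U (z + unitv i) - cavg m U z| <= 2 * (b * m%:R `^ (- (d%:R / q))).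
Proof.
move=> q1 m0 b0 Ub zB; rewrite cavg_grad.
have q0 : 0 < q by exact: lt_le_trans q1.
have H := cavg_powR_le (fun y => U (y + unitv i) - U y) z q1 m0.
set A := `|_| in H *.
suff : A `^ q <= (2 * (b * m%:R `^ (- (d%:R / q)))) `^ q.
  apply: contraTT; rewrite -!ltNge => lt; apply: gt0_ltr_powR => //.
    by rewrite nnegrE !mulr_ge0 ?powR_ge0.
  by rewrite nnegrE /A.
apply: le_trans H _; rewrite powRM ?mulr_ge0 ?powR_ge0// powRM ?powR_ge0//.
rewrite ler_wpM2l ?powR_ge0// -powRrM mulNr divfK ?gt_eqF// powRN powR_mulrn// -natrX.
rewrite ler_wpM2r ?invr_ge0 ?ler0n//; apply: le_trans (Ub i).
case: (posnP n) => [n0|n0]; last first.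
  apply: (cube_sum_le (f := fun y => `|U (y + unitv i) - U y| `^ q)) => [||j].
  - by rewrite muln_gt0 n0.
  - by move=> y; exact: powR_ge0.
  - by rewrite !mxE; have := zB j; lia.
have := zB i; rewrite n0; lia.
Qed.

Lemma geo_sum_le (r : R) k : 1 < r -> \sum_(j < k) r ^+ j <= r ^+ k / (r - 1).
Proof.
move=> r1; have r1' : 0 < r - 1 by rewrite subr_gt0.
rewrite ler_pdivlMr// mulrC -subrX1 gerBl.
by [].
Qed.

(* The averages of [U] over the cubes [x + [0,2^j)^d] are compared for
   successive [j] by passing through the average over both scales. *)
Lemma morrey_sum (U : Zd -> R) (q b : R) k x : 1 <= q -> d%:R < q -> 0 <= b ->
  (forall i, \sum_(v : {ffun 'I_d -> 'I_(8 * 2 ^ k)})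
     `|U (corner (4 * 2 ^ k) + vec v + unitv i) - U (corner (4 * 2 ^ k) + vec v)| `^ q
       <= b `^ q) ->
  (forall j, - (2 ^ k)%:Z <= x 0 j <= (2 ^ k)%:Z) ->
  forall r, r = 2 `^ (1 - d%:R / q) ->
  `|U x - U 0| <= 8 * d%:R * b * r ^+ k * (3 / (r - 1) + 1).
Proof.
move=> q1 dq b0 Ub xB r r_def; have q0 : 0 < q by exact: lt_le_trans q1.
(* This is where [d < q] acts: with a ratio above 1 the sum over scales is at most a multiple of its
   last term. *)
have r1 : 1 < r.
  rewrite r_def -[ltLHS](powRr0 (2 : R)) /powR ifF ?gt_eqF//.
  rewrite ltr_expR ltr_pM2r ?ln_gt0 ?ltr1n//.
  by rewrite subr_gt0 ltr_pdivrMr// mul1r.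
have rE j : (2 ^ j)%:R * (2 ^ j)%:R `^ (- (d%:R / q)) = r ^+ j.
  have p0 : 0 < (2 ^ j)%:R :> R by rewrite ltr0n expn_gt0.
  rewrite -{1}(powRr1 (ltW p0)) -powRD; last by rewrite (gt_eqF p0) implybT.
  by rewrite r_def -[RHS]powR_mulrn ?powR_ge0// powRAC powR_mulrn// natrX.
pose M m := 2 * (b * m%:R `^ (- (d%:R / q))).
have M_ge0 m : 0 <= M m by rewrite !mulr_ge0// powR_ge0.
have ME j : (2 ^ j)%:R * M (2 ^ j)%N = 2 * b * r ^+ j by rewrite -rE /M; ring.
(* By [ME], [m * M m] equals [2 * b * r ^+ j]. The two comparisons with the double average cost
   [4 d m M m] and [2 d m M m], whence the constant 12. *)
have step y j : (forall l, - (2 ^ k)%:Z <= y 0 l <= (2 ^ k)%:Z) -> (j < k)%N ->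
    `|cavg (2 ^ j) U y - cavg (2 ^ j.+1) U y| <= 12 * d%:R * b * r ^+ j.
  move=> yB jk; set m := (2 ^ j)%N; set n := (2 ^ k)%N.
  have m0 : (0 < m)%N by rewrite expn_gt0.
  have mn : (2 * m <= n)%N by rewrite -expnS leq_exp2l.
  have -> : (2 ^ j.+1)%N = (2 * m)%N by rewrite expnS.
  have m20 : (0 < 2 * m)%N by rewrite muln_gt0 m0.
  have h1 : `|cavg (2 * m) (cavg m U) y - cavg m U y| <= (2 * d * (2 * m))%:R * M m.
    apply: cavg_near => // z i zB; apply: (@grad_cavg_le _ _ _ _ n) => // l.
    by have := zB l; have := yB l; lia.
  have h2 : `|cavg m (cavg (2 * m) U) y - cavg (2 * m) U y| <= (2 * d * m)%:R * M m.
    apply: cavg_near => // z i zB.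
    apply: (@le_trans _ _ (M (2 * m)%N)).
      apply: (@grad_cavg_le _ _ _ _ n) => // l.
      by have := zB l; have := yB l; lia.
    rewrite ler_wpM2l// ler_wpM2l// !powRN lef_pV2 ?posrE ?powR_gt0 ?ltr0n//.
    by rewrite ge0_ler_powR ?nnegrE ?divr_ge0 ?(ltW q0)// ler_nat; lia.
  rewrite cavgC in h2.
  have -> : 12 * d%:R * b * r ^+ j = (2 * d * (2 * m))%:R * M m + (2 * d * m)%:R * M m.
    have := ME j; rewrite -/m => mM.
    transitivity (6 * d%:R * (m%:R * M m)); first by rewrite mM; ring.
    by rewrite !natrM; ring.
  set a := cavg _ (cavg _ U) y in h1 h2.
  have -> : cavg m U y - cavg (2 * m) U y = (a - cavg (2 * m) U y) - (a - cavg m U y) by ring.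
  by rewrite (le_trans (ler_normB _ _))// addrC lerD.
have chain y : (forall l, - (2 ^ k)%:Z <= y 0 l <= (2 ^ k)%:Z) ->
    `|U y - cavg (2 ^ k) U y| <= 12 * d%:R * b * (r ^+ k / (r - 1)).
  move=> yB; have stepy := fun j => step y j yB; apply: (@le_trans _ _ (12 * d%:R * b * \sum_(j < k) r ^+ j)); last first.
    by rewrite ler_wpM2l ?mulr_ge0 ?geo_sum_le.
  suff H k' : (k' <= k)%N -> `|U y - cavg (2 ^ k') U y| <=
      12 * d%:R * b * \sum_(j < k') r ^+ j by exact: H.
  elim: k' => [_|j IH jk].
    rewrite big_ord0 mulr0 distrC expn0; apply: cavg_dist => // v.
    rewrite (_ : y + vec v = y) ?subrr ?normr0//.
    by apply/rowP => i; rewrite !mxE ord1 addr0.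
  rewrite big_ord_recr/= mulrDr.
  have -> : U y - cavg (2 ^ j.+1) U y = (U y - cavg (2 ^ j) U y) +
    (cavg (2 ^ j) U y - cavg (2 ^ j.+1) U y) by ring.
  by rewrite (le_trans (ler_normD _ _))// lerD ?IH ?stepy// ltnW.
have last_step : `|cavg (2 ^ k) U x - cavg (2 ^ k) U 0| <= 8 * d%:R * b * r ^+ k.
  have -> : 8 * d%:R * b * r ^+ k = (2 * d * (2 * 2 ^ k))%:R * M (2 ^ k)%N.
    transitivity (4 * d%:R * ((2 ^ k)%:R * M (2 ^ k)%N)); first by rewrite ME; ring.
    by rewrite !natrM; ring.
  apply: (lip_box (lo := corner (2 ^ k))) => // [z i zB|j|j].
  - apply: (@grad_cavg_le _ _ _ _ (2 ^ k)) => // [|l]; first by rewrite expn_gt0.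
    by have := zB l; rewrite mxE; lia.
  - by have := xB j; rewrite mxE; lia.
  - by rewrite !mxE; lia.
have stepx : `|U x - cavg (2 ^ k) U x| <= 12 * d%:R * b * (r ^+ k / (r - 1)).
  exact: chain.
have step0 : `|U 0 - cavg (2 ^ k) U 0| <= 12 * d%:R * b * (r ^+ k / (r - 1)).
  by apply: chain => j; rewrite mxE; lia.
have -> : U x - U 0 = (U x - cavg (2 ^ k) U x) +
    (cavg (2 ^ k) U x - cavg (2 ^ k) U 0) - (U 0 - cavg (2 ^ k) U 0) by ring.
have -> : 8 * d%:R * b * r ^+ k * (3 / (r - 1) + 1) =
    12 * d%:R * b * (r ^+ k / (r - 1)) + 8 * d%:R * b * r ^+ k +
    12 * d%:R * b * (r ^+ k / (r - 1)) by ring.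
rewrite (le_trans (ler_normB _ _))// lerD// (le_trans (ler_normD _ _))// lerD//.
Qed.

Lemma morrey (q : R) : 1 <= q -> d%:R < q -> exists2 C : R, 0 <= C &
  forall (U : Zd -> R) k (eta : R), 0 <= eta ->
  (forall i, cavg (8 * 2 ^ k) (fun z => `|U (z + unitv i) - U z| `^ q)
     (corner (4 * 2 ^ k)) <= eta) ->
  forall x, (forall j, - (2 ^ k)%:Z <= x 0 j <= (2 ^ k)%:Z) ->
  `|U x - U 0| <= C * eta `^ q^-1 * (2 ^ k)%:R.
Proof.
move=> q1 dq; have q0 : 0 < q by exact: lt_le_trans q1.
have r1 : 1 < 2 `^ (1 - d%:R / q).
  rewrite -[ltLHS](powRr0 (2 : R)) /powR ifF ?gt_eqF//.
  rewrite ltr_expR ltr_pM2r ?ln_gt0 ?ltr1n//.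
  by rewrite subr_gt0 ltr_pdivrMr// mul1r.
exists (8 * d%:R * 8 `^ (d%:R / q) * (3 / (2 `^ (1 - d%:R / q) - 1) + 1)).
  by rewrite !mulr_ge0 ?powR_ge0// addr_ge0// divr_ge0// subr_ge0 ltW.
move=> U k eta eta0 Ueta x xB.
(* The second factor turns a mean into a sum over [(8 * 2 ^ k) ^ d] points. It contributes
   [(2^k)^(d/q)], which multiplies [r ^+ k = (2^k)^(1 - d/q)] to exactly [2 ^ k], so that [C] does
   not depend on [k]. *)
pose b := eta `^ q^-1 * (8 * 2 ^ k)%:R `^ (d%:R / q).
have b0 : 0 <= b by rewrite mulr_ge0 ?powR_ge0.
have bq : b `^ q = eta * ((8 * 2 ^ k) ^ d)%:R.
  rewrite powRM ?powR_ge0// -!powRrM mulVf ?gt_eqF// powRr1// divfK ?gt_eqF//.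
  by rewrite powR_mulrn// natrX.
have n0 : 0 < (2 ^ k)%:R :> R by rewrite ltr0n expn_gt0.
have Ub i : \sum_(v : {ffun 'I_d -> 'I_(8 * 2 ^ k)})
     `|U (corner (4 * 2 ^ k) + vec v + unitv i) - U (corner (4 * 2 ^ k) + vec v)| `^ q
       <= b `^ q.
  rewrite bq -ler_pdivrMr ?expn_cube_gt0 ?muln_gt0 ?expn_gt0//.
  exact: Ueta.
apply: le_trans (morrey_sum q1 dq b0 Ub xB (erefl _)) _.
set c := 3 / _ + 1; rewrite le_eqVlt; apply/orP; left; apply/eqP.
rewrite /b natrM powRM// -[(2 `^ _) ^+ k]powR_mulrn ?powR_ge0// powRAC powR_mulrn// -natrX.
have nE : (2 ^ k)%:R `^ (1 - d%:R / q) * (2 ^ k)%:R `^ (d%:R / q) = (2 ^ k)%:R :> R.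
  by rewrite -powRD ?subrK ?powRr1// ?(ltW n0)// (gt_eqF n0) implybT.
rewrite -[in RHS]nE; ring.
Qed.

End Lattice.


(** * The maximal inequality on the lattice *)

Section Transference.
Context (R : realType) (d : nat).
Local Notation Zd := 'rV[int]_d.

(** A weak type bound on a finite window, from [vitali_count] with the number of points of a cube as
    weight and [2 ^ d] as constant. *)
Lemma maximal_count (F : Zd -> R) (t : R) (K : nat) :
  (forall z, 0 <= F z) -> 0 <= t ->
  t * #|[pred v : {ffun 'I_d -> 'I_(8 * 2 ^ K)} |
     [exists k : 'I_K.+1, t < cavg (8 * 2 ^ k) F (corner d (4 * 2 ^ k) + vec v)]]|%:R
  <= (2 ^ d)%:R * \sum_(u : {ffun 'I_d -> 'I_(2 * (8 * 2 ^ K))})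
       F (corner d (4 * 2 ^ K) + vec u).
Proof.
move=> F0 t0; set L := (8 * 2 ^ K)%N; have LE : L = (8 * 2 ^ K)%N by [].
set D := [pred v | _].
(* One scale at which [v] is exceptional; the default [ord0] only concerns points outside [D]. *)
pose kk (v : {ffun 'I_d -> 'I_L}) : 'I_K.+1 :=
  odflt ord0 [pick k : 'I_K.+1 | t < cavg (8 * 2 ^ k) F (corner d (4 * 2 ^ k) + vec v)].
have kkP v : v \in D -> t < cavg (8 * 2 ^ kk v) F (corner d (4 * 2 ^ kk v) + vec v).
  rewrite inE => /existsP[k tk]; rewrite /kk; case: pickP => //= /(_ k).
  by rewrite tk.
pose rad v := (2 ^ kk v)%N.
have rad_le v : (0 < rad v <= 2 ^ K)%N.
  by rewrite expn_gt0/= leq_exp2l// -ltnS ltn_ord.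
(* Cubes centred in [[0,L)^d] have half-side at most [4 * 2 ^ K], which is [L / 2], so a window of
   side [2 * L] contains them all. *)
pose pt (u : {ffun 'I_d -> 'I_(2 * L)}) : Zd := corner d (4 * 2 ^ K) + vec u.
pose inQ (v : {ffun 'I_d -> 'I_L}) (y : Zd) :=
  [forall i, - (4 * rad v)%:Z <= y 0 i - (v i)%:Z < (4 * rad v)%:Z].
pose Q v u := inQ v (pt u).
have ptE u i : pt u 0 i = (u i)%:Z - (4 * 2 ^ K)%:Z by rewrite !mxE addrC.
have Qn0 v : exists u, Q v u.
  pose g i : nat := (v i + 4 * 2 ^ K)%N.
  have gL i : (g i < 2 * L)%N.
    by rewrite /g; have := ltn_ord (v i); have := rad_le v; lia.
  exists [ffun i => Ordinal (gL i)]; apply/forallP => i; rewrite ptE ffunE /= /g.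
  have := rad_le v; lia.
(* If a cube of no larger radius meets that of [v], the centres differ by less than [8 * rad v] in
   each coordinate. This leaves at most [(16 * rad v) ^ d] centres, which is [2 ^ d] times the
   weight. *)
have near v : v \in D ->
    #|[pred z in D | (rad z <= rad v)%N && [exists u, Q z u && Q v u]]|%:R
      <= (2 ^ d)%:R * ((8 * rad v) ^ d)%:R :> R.
  move=> vD; rewrite -natrM -expnMn ler_nat.
  have -> : (2 * (8 * rad v) = (16 * rad v).-1.+1)%N by have := rad_le v; lia.
  set m := (16 * rad v).-1; rewrite -(card_cube d m.+1).
  pose h (z : {ffun 'I_d -> 'I_L}) : {ffun 'I_d -> 'I_m.+1} :=
    [ffun i => inord (z i + 8 * rad v - v i)].
  set A := [pred z | _].
  have hE z i : z \in A -> (h z i : nat) = (z i + 8 * rad v - v i)%N /\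
      (v i < z i + 8 * rad v)%N.
    rewrite inE => /and3P[zD zv /existsP[u /andP[/forallP/(_ i) zu /forallP/(_ i) vu]]].
    rewrite ffunE inordK; move: zv zu vu; rewrite /m; have := rad_le v; lia.
  have h_inj : {in A &, injective h}.
    move=> z z' zA z'A hz; apply/ffunP => i; apply: val_inj => /=.
    have [e1 l1] := hE z i zA; have [e2 l2] := hE z' i z'A.
    by move: e1; rewrite hz e2; lia.
  by rewrite -(card_in_imset h_inj) max_card.
have heavy v : v \in D -> t * ((8 * rad v) ^ d)%:R <= \sum_(u | Q v u) F (pt u).
  move=> vD; have := ltW (kkP v vD).
  have r0 : (0 < 8 * rad v)%N by have := rad_le v; lia.
  rewrite /cavg ler_pdivlMr ?expn_cube_gt0// => /le_trans; apply.
  rewrite [leRHS]big_mkcond/=.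
  pose G y := if inQ v y then F y else 0.
  have G0 y : 0 <= G y by rewrite /G; case: ifP.
  apply: (@le_trans _ _ (\sum_(u : {ffun 'I_d -> 'I_(8 * rad v)})
      G (corner d (4 * rad v) + vec v + vec u))).
    apply: ler_sum => u _; rewrite /G ifT//; apply/forallP => i.
    have -> : (corner d (4 * rad v) + vec v + vec u) 0 i =
        - (4 * rad v)%:Z + (v i)%:Z + (u i)%:Z by rewrite !mxE.
    have ui : (u i < 8 * rad v)%N := ltn_ord (u i); lia.
  apply: cube_sum_le => // [|i]; first by rewrite /L !muln_gt0 expn_gt0.
  have -> : (corner d (4 * rad v) + vec v) 0 i = - (4 * rad v)%:Z + (v i)%:Z.
    by rewrite !mxE.
  rewrite mxE; have := rad_le v; have := ltn_ord (v i); lia.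
have /= := vitali_count t0 (fun u => F0 (pt u)) (ler0n _ _) Qn0 near heavy.
move/le_trans; apply; rewrite ler_wpM2l//.
by rewrite [leRHS](bigID (fun u => [exists x in D, Q x u]))/= lerDl sumr_ge0.
Qed.

End Transference.


(** * The maximal inequality *)

Section RealIntegrals.
Context (R : realType) (dsp : measure_display) (Om : measurableType dsp)
  (P : probability Om R).
Implicit Types (f g : Om -> R).

Lemma ge0_intZl k f : 0 <= k -> measurable_fun setT f -> (forall w, 0 <= f w) ->
  (\int[P]_w (k * f w)%:E = k%:E * \int[P]_w (f w)%:E)%E.
Proof.
move=> k0 mf f0; under eq_integral do rewrite EFinM.
rewrite ge0_integralZl_EFin//; first by move=> w _; rewrite lee_fin.
exact/measurable_EFinP.
Qed.

Lemma ge0_intD f g : measurable_fun setT f -> (forall w, 0 <= f w) ->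
  measurable_fun setT g -> (forall w, 0 <= g w) ->
  (\int[P]_w (f w + g w)%:E = \int[P]_w (f w)%:E + \int[P]_w (g w)%:E)%E.
Proof.
move=> mf f0 mg g0; under eq_integral do rewrite EFinD.
rewrite ge0_integralD//; first by move=> w _; rewrite lee_fin.
- exact/measurable_EFinP.
- by move=> w _; rewrite lee_fin.
- exact/measurable_EFinP.
Qed.

Lemma ge0_int_le f g : measurable_fun setT f -> measurable_fun setT g ->
  (forall w, 0 <= f w) -> (forall w, f w <= g w) ->
  (\int[P]_w (f w)%:E <= \int[P]_w (g w)%:E)%E.
Proof.
move=> mf mg f0 fg; apply: ge0_le_integral => //.
- by move=> w _; rewrite lee_fin.
- exact/measurable_EFinP.
- exact/measurable_EFinP.
- by move=> w _; rewrite lee_fin.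
Qed.

Lemma measurable_gt_cst f (t : R) : measurable_fun setT f ->
  measurable [set w | t < f w].
Proof.
move=> mf; rewrite (_ : [set _ | _] = setT `&` f @^-1` `]t, +oo[).
  exact: mf.
by rewrite setTI; apply/seteqP; split=> w /=; rewrite in_itv/= andbT.
Qed.

Lemma probability_integral_cst (c : R) : (\int[P]_w c%:E = c%:E)%E.
Proof.
rewrite integral_cst//.
have -> : (c%:E * P setT = c%:E)%E by rewrite probability_setT mule1.
by [].
Qed.

End RealIntegrals.

Section Action.
Context (R : realType) (dsp : measure_display) (Om : measurableType dsp)
  (P : probability Om R) (d : nat) (S : 'rV[int]_d -> Om -> Om).
Local Notation Zd := 'rV[int]_d.
Hypotheses (S0 : forall w, S 0 w = w)
  (SD : forall x y w, S (x + y) w = S x (S y w))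
  (mS : forall x, measurable_fun setT (S x))
  (PS : forall x (A : set Om), measurable A -> P (S x @^-1` A) = P A).
Implicit Types (f g : Om -> R) (x y : Zd).

Lemma ge0_integral_shift f x : measurable_fun setT f -> (forall w, 0 <= f w) ->
  (\int[P]_w (f (S x w))%:E = \int[P]_w (f w)%:E)%E.
Proof.
move=> mf f0; have mfE : measurable_fun setT (EFin \o f) by exact/measurable_EFinP.
have := @ge0_integral_pushforward _ _ _ _ R (S x) (mS x) P setT (EFin \o f)
  measurableT mfE.
rewrite preimage_setT => <-; last by move=> w _; rewrite /= lee_fin.
apply: eq_measure_integral => A mA _.
by rewrite /= /pushforward PS.
Qed.

Definition oavg n f x w : R := cavg n (fun z => f (S z w)) x.

Lemma oavg_shift n f x y w : oavg n f x (S y w) = oavg n f (x + y) w.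
Proof.
rewrite /oavg /cavg; congr (_ / _); apply: eq_bigr => v _.
by rewrite -SD; congr (f (S _ w)); rewrite addrAC.
Qed.

Lemma oavg_shift0 n f y w : oavg n f 0 (S y w) = oavg n f y w.
Proof. by rewrite oavg_shift add0r. Qed.

Lemma measurable_shift f x : measurable_fun setT f ->
  measurable_fun setT (fun w => f (S x w)).
Proof. by move=> mf; exact: measurableT_comp. Qed.

Lemma measurable_oavg n f x : measurable_fun setT f ->
  measurable_fun setT (oavg n f x).
Proof.
move=> mf; apply: measurable_funM => //; apply: measurable_sum => v.
exact: measurable_shift.
Qed.

Lemma oavg_ge0 n f x w : (forall w, 0 <= f w) -> 0 <= oavg n f x w.
Proof. by move=> f0; rewrite divr_ge0// sumr_ge0. Qed.

Lemma ge0_integral_cube_sum n f x : measurable_fun setT f -> (forall w, 0 <= f w) ->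
  (\int[P]_w (\sum_(v : {ffun 'I_d -> 'I_n}) f (S (x + vec v) w))%:E
    = (n ^ d)%:R%:E * \int[P]_w (f w)%:E)%E.
Proof.
move=> mf f0; under eq_integral do rewrite -sumEFin.
rewrite ge0_integral_sum//; last first.
- by move=> v w _; rewrite lee_fin.
- by move=> v; apply/measurable_EFinP; exact: measurable_shift.
under eq_bigr do rewrite ge0_integral_shift//.
rewrite big_const card_cube; elim: (_ ^ _)%N => [|m IH].
  by rewrite mul0e.
by rewrite iterS IH -natr1 EFinD ge0_muleDl ?lee_fin// mul1e addeC.
Qed.

Lemma ge0_integral_oavg n f x : (0 < n)%N -> measurable_fun setT f ->
  (forall w, 0 <= f w) ->
  (\int[P]_w (oavg n f x w)%:E = \int[P]_w (f w)%:E)%E.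
Proof.
move=> n0 mf f0.
under eq_integral do rewrite /oavg /cavg mulrC.
rewrite ge0_intZl ?invr_ge0//; last 2 first.
- by apply: measurable_sum => v; exact: measurable_shift.
- by move=> w; rewrite sumr_ge0.
rewrite ge0_integral_cube_sum// muleA -EFinM mulVf ?mul1e//.
by rewrite gt_eqF// expn_cube_gt0.
Qed.

(* The counting bound is integrated over a window of side [8 * 2 ^ K], the side
   of the largest cube; a larger window would only improve the constant. *)
Lemma maximal_ineq f (t : R) : measurable_fun setT f -> (forall w, 0 <= f w) ->
  0 < t ->
  (P [set w | exists k, (t < oavg (8 * 2 ^ k) f (corner d (4 * 2 ^ k)) w)%R]
    <= ((4 ^ d)%:R / t)%:E * \int[P]_w (f w)%:E)%E.
Proof.
move=> mf f0 t0.
pose E K := [set w | [exists k : 'I_K.+1, t < oavg (8 * 2 ^ k) f (corner d (4 * 2 ^ k)) w]].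
have mE K : measurable (E K).
  have -> : E K = \bigcup_(k < K.+1)
      [set w | t < oavg (8 * 2 ^ k) f (corner d (4 * 2 ^ k)) w].
    apply/seteqP; split => w /=.
      by move=> /existsP[k tk]; exists k => //=.
    by move=> [k /= kK tk]; apply/existsP; exists (Ordinal kK).
  apply: bigcup_measurable => k _.
  exact/measurable_gt_cst/measurable_oavg.
have -> : [set w | exists k, t < oavg (8 * 2 ^ k) f (corner d (4 * 2 ^ k)) w] = \bigcup_K E K.
  apply/seteqP; split => w /=.
    by move=> [k tk]; exists k => //=; apply/existsP; exists ord_max.
  by move=> [K _ /existsP[k tk]]; exists k.
have ndE : nondecreasing_seq E.
  move=> K L KL; apply/subsetPset => w /= /existsP[k tk]; apply/existsP.
  by exists (widen_ord (leq_ltn_trans KL (ltnSn L)) k).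
have := nondecreasing_cvg_mu (mu := P) mE (bigcup_measurable (fun k _ => mE k)) ndE.
move=> cvgE; rewrite -(cvg_lim _ cvgE)//; apply: lime_le; first exact: cvgP cvgE.
apply: nearW => K.
set L := (8 * 2 ^ K)%N; have L0 : (0 < L)%N by rewrite muln_gt0 expn_gt0.
have Ld0 : 0 < (L ^ d)%:R :> R by exact: expn_cube_gt0.
(* Transference: along the orbit of [w], visits to [E K] are the exceptional points of the lattice
   inequality for the function sending [z] to [f (S z w)]. *)
have count w : t * \sum_(v : {ffun 'I_d -> 'I_L}) \1_(E K) (S (0 + vec v) w) <=
    (2 ^ d)%:R * \sum_(u : {ffun 'I_d -> 'I_(2 * L)}) f (S (corner d (4 * 2 ^ K) + vec u) w).
  apply: le_trans (maximal_count K (fun z => f0 (S z w)) (ltW t0)).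
  rewrite ler_wpM2l ?(ltW t0)// -sum1_card natr_sum [leRHS]big_mkcond/=.
  apply: ler_sum => v _; rewrite add0r indicE; case: ifPn => vE.
    by case: (_ \in _).
  rewrite (_ : _ \in _ = false)//; apply/negbTE; apply: contra vE.
  rewrite [in X in X -> _]inE => /existsP[k tk]; rewrite inE; apply/existsP; exists k.
  by move: tk; rewrite oavg_shift.
(* Invariance of [P] makes every term of a sum contribute equally. The factor [L ^ d] then cancels
   and [2 ^ d * 2 ^ d = 4 ^ d] remains, whatever [K] is. *)
have intcount : (t%:E * ((L ^ d)%:R%:E * P (E K)) <=
    (2 ^ d)%:R%:E * (((2 * L) ^ d)%:R%:E * \int[P]_w (f w)%:E))%E.
  have mind : measurable_fun setT (\1_(E K) : Om -> R) by exact: measurable_indic.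
  rewrite -(@ge0_integral_cube_sum _ _ (corner d (4 * 2 ^ K)))//.
  have -> : (P (E K) = \int[P]_w (\1_(E K) w)%:E)%E by rewrite integral_indic// setIT.
  rewrite -(@ge0_integral_cube_sum _ _ 0)//.
  rewrite -!ge0_intZl ?(ltW t0)//;
    try (by apply: measurable_sum => v; exact: measurable_shift);
    try (by move=> w; rewrite sumr_ge0).
  apply: ge0_int_le => //.
  - apply: measurable_funM => //.
    by apply: measurable_sum => v; exact: measurable_shift.
  - apply: measurable_funM => //.
    by apply: measurable_sum => v; exact: measurable_shift.
  - by move=> w; rewrite mulr_ge0 ?(ltW t0)// sumr_ge0.
move: intcount; rewrite !muleA -!EFinM => intcount.
rewrite -(@lee_pmul2l _ (t * (L ^ d)%:R)%:E) ?lte_fin ?mulr_gt0//.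
apply: le_trans intcount _.
rewrite muleA -EFinM; apply: lee_wpmul2r; first by apply: integral_ge0 => w _; rewrite lee_fin.
rewrite lee_fin expnMn [(4 ^ d)%N](_ : _ = (2 ^ d * 2 ^ d)%N); last by rewrite -expnMn.
by rewrite !natrM le_eqVlt; apply/orP; left; apply/eqP; field; rewrite gt_eqF.
Qed.

Lemma ae_summable (h : nat -> Om -> R) (c r : R) :
  (forall k, measurable_fun setT (h k)) -> (forall k w, 0 <= h k w) ->
  0 <= c -> 0 <= r < 1 ->
  (forall k, \int[P]_w (h k w)%:E <= (c * r ^+ k)%:E)%E ->
  {ae P, forall w, cvgn (series (h ^~ w))}.
Proof.
move=> mh h0 c0 /andP[r0 r1] hcr.
have mhE k : measurable_fun setT (EFin \o h k) by exact/measurable_EFinP.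
have h0E k w : setT w -> (0 <= (EFin \o h k) w)%E by rewrite lee_fin.
have fin : (\sum_(k <oo) \int[P]_w (h k w)%:E < +oo)%E.
  apply: (@le_lt_trans _ _ (c / (1 - r))%:E); last exact: ltry.
  apply: lime_le.
    by apply: is_cvg_nneseries => k _ _; apply: integral_ge0 => w _; rewrite lee_fin.
  apply: nearW => n; apply: (@le_trans _ _ (\sum_(0 <= k < n) (c * r ^+ k)%:E)%E).
    by apply: lee_sum => k _; exact: hcr.
  rewrite sumEFin lee_fin -mulr_sumr ler_wpM2l// -[leRHS]mul1r ler_pdivlMr ?subr_gt0//.
  have := subrX1 r n; rewrite big_mkord => rn.
  have -> : (\sum_(i < n) r ^+ i) * (1 - r) = - ((r - 1) * \sum_(i < n) r ^+ i) by ring.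
  rewrite -rn opprB.
  by rewrite gerBl exprn_ge0.
have int : P.-integrable setT (fun w => \sum_(k <oo) (h k w)%:E)%E.
  apply/integrableP; split.
    apply: (ge0_emeasurable_sum (h := fun k => EFin \o h k) (P := xpredT)) => k *.
      exact: h0E.
    exact: mhE.
  rewrite (eq_integral (fun w => \sum_(k <oo) (h k w)%:E))%E; last first.
    by move=> w _; rewrite gee0_abs// nneseries_ge0// => k _ _; rewrite lee_fin.
  by rewrite (@integral_nneseries _ _ _ P setT measurableT (fun k => EFin \o h k)).
have := integrable_ae measurableT int.
apply: filterS => w /(_ Logic.I) finw.
by apply: nnseries_is_cvg => //; rewrite ltey_eq finw.
Qed.

(** A maximum over a cube is bounded by the sum over it. The normalised sum [h k] of [q]-th powers
    over [(8 * 2 ^ k) ^ d] points has a mean proportional to [2^((d-q)k)], which is summable. Hence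
    [h k] tends to 0 almost surely, and it dominates each of its terms. *)
Lemma Lq_sublinear f (q : R) : measurable_fun setT f -> d%:R < q ->
  (\int[P]_w (`|f w| `^ q)%:E < +oo)%E ->
  {ae P, forall w, forall e : R, 0 < e -> exists k0, forall k, (k0 <= k)%N ->
    forall x, (forall j, - (4 * 2 ^ k)%:Z <= x 0 j < (4 * 2 ^ k)%:Z) ->
    `|f (S x w)| <= e * (2 ^ k)%:R}.
Proof.
move=> mf dq fin; have q0 : 0 < q by exact: le_lt_trans dq.
pose h k w := (2 ^ k)%:R `^ (- q) * \sum_(v : {ffun 'I_d -> 'I_(8 * 2 ^ k)})
  `|f (S (corner d (4 * 2 ^ k) + vec v) w)| `^ q.
have mfq : measurable_fun setT (fun w => `|f w| `^ q).
  apply: (measurableT_comp (measurable_powR q)).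
  exact: measurableT_comp.
have fq0 w : 0 <= `|f w| `^ q by exact: powR_ge0.
have mh k : measurable_fun setT (h k).
  apply: measurable_funM => //; apply: measurable_sum => v.
  exact: (measurable_shift _ mfq).
have h0 k w : 0 <= h k w by rewrite mulr_ge0 ?powR_ge0// sumr_ge0.
have Efin : (\int[P]_w (`|f w| `^ q)%:E)%E \is a fin_num.
  by rewrite ge0_fin_numE// integral_ge0// => w _; rewrite lee_fin.
set E := fine (\int[P]_w (`|f w| `^ q)%:E)%E.
have E0 : 0 <= E by rewrite fine_ge0// integral_ge0// => w _; rewrite lee_fin.
have r01 : 0 <= (2 : R) `^ (d%:R - q) < 1.
  rewrite powR_ge0/= /powR ifF ?gt_eqF// -[ltRHS]expR0 ltr_expR.
  by rewrite nmulr_rlt0 ?ln_gt0 ?ltr1n// subr_lt0.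
have hint k : (\int[P]_w (h k w)%:E <= ((8 ^ d)%:R * E * (2 `^ (d%:R - q)) ^+ k)%:E)%E.
  rewrite ge0_intZl ?powR_ge0//; [|apply: measurable_sum => v;
    exact: (measurable_shift _ mfq)|by move=> w; rewrite sumr_ge0].
  rewrite (@ge0_integral_cube_sum _ (fun w => `|f w| `^ q))//.
  rewrite -[X in (_ * (_ * X))%E]fineK// -!EFinM lee_fin -/E.
  have n0 : 0 < (2 ^ k)%:R :> R by rewrite ltr0n expn_gt0.
  rewrite le_eqVlt; apply/orP; left; apply/eqP.
  rewrite -[(2 `^ _) ^+ k]powR_mulrn ?powR_ge0// powRAC powR_mulrn// -natrX.
  rewrite powRD ?(gt_eqF n0) ?implybT// [X in _ = _ * (X * _)]powR_mulrn// -natrX.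
  by rewrite expnMn !natrM; ring.
have := ae_summable mh h0 (mulr_ge0 (ler0n _ _) E0) r01 hint.
apply: filterS => w /cvg_series_cvg_0 hcv e e0.
have eq0 : 0 < e `^ q by exact: powR_gt0.
have [k0 _ hk0] := cvgr_lt 0 hcv _ eq0.
exists k0 => k k0k x xB; have /= := hk0 k k0k.
have n0 : 0 < (2 ^ k)%:R :> R by rewrite ltr0n expn_gt0.
have xE : exists v : {ffun 'I_d -> 'I_(8 * 2 ^ k)}, x = corner d (4 * 2 ^ k) + vec v.
  have gB j : (`|(x 0%R j + (4 * 2 ^ k)%:Z)%R|%N < 8 * 2 ^ k)%N.
    by move: (xB j); move: (2 ^ k)%N (x 0 j) => m z; clear; lia.
  exists [ffun j => Ordinal (gB j)]; apply/rowP => j.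
  rewrite !mxE ffunE /=; move: (xB j); move: (2 ^ k)%N (x 0 j) => m z.
  by clear; lia.
have [v ->] := xE.
rewrite /h (bigD1 v)//= => hlt.
suff : `|f (S (corner d (4 * 2 ^ k) + vec v) w)| `^ q <= (e * (2 ^ k)%:R) `^ q.
  apply: contraTT; rewrite -!ltNge => lt; apply: gt0_ltr_powR => //.
  by rewrite nnegrE mulr_ge0 ?(ltW e0).
rewrite powRM ?(ltW e0) ?(ltW n0)// -ler_pdivrMr ?powR_gt0//.
rewrite -powRN mulrC; apply: le_trans (ltW hlt).
by rewrite ler_wpM2l ?powR_ge0// lerDl sumr_ge0.
Qed.

End Action.


(** * The mean ergodic theorem *)

Section Folner.
Context (R : realType) (d : nat).
Local Notation Zd := 'rV[int]_d.
Implicit Types (F : Zd -> R).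

(** The indicator of a face is a product over coordinates. Multiplying by the side keeps the
    exponent [d - 1] out of the statement. *)
Lemma sum_face L (i : 'I_d) :
  (\sum_(v : {ffun 'I_d -> 'I_L.+1}) (v i == ord_max)%:R) * L.+1%:R
    = (L.+1 ^ d)%:R :> R.
Proof.
pose g (j : 'I_d) (a : 'I_L.+1) : R := if j == i then (a == ord_max)%:R else 1.
have gE (v : {ffun 'I_d -> 'I_L.+1}) : (v i == ord_max)%:R = \prod_j g j (v j).
  rewrite (bigD1 i)//= big1 ?mulr1 /g ?eqxx// => j /negbTE ->.
  by [].
rewrite (eq_bigr _ (fun v _ => gE v)) -(bigA_distr_bigA g) (bigD1 i)//=.
have -> : \sum_j g i j = 1.
  rewrite /g eqxx (bigD1 ord_max)//= eqxx big1 ?addr0// => a /negbTE ->.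
  by [].
rewrite mul1r (eq_bigr (fun=> L.+1%:R)); last first.
  by move=> j /negbTE ji; rewrite /g ji sumr_const card_ord.
by rewrite prodr_const cardC1 card_ord -natrX -natrM -expnSr prednK// (leq_ltn_trans _ (ltn_ord i)).
Qed.

(* After a cyclic rotation of the [i]-th coordinate the two cubes agree up to a
   single face. *)
Lemma cavg_grad_bounded F (K : R) L x i : (0 < L)%N ->
  (forall z, `|F z| <= K) ->
  `|cavg L F (x + unitv i) - cavg L F x| <= 2 * K / L%:R.
Proof.
case: L => // L _ FK.
pose rot (v : {ffun 'I_d -> 'I_L.+1}) : {ffun 'I_d -> 'I_L.+1} :=
  [ffun j => if j == i then ordS (v j) else v j].
have rot_inj : injective rot.
  move=> u v uv; apply/ffunP => j; have := congr1 (fun h : {ffun _} => h j) uv.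
  by rewrite !ffunE; case: ifP => // _ /(can_inj (@ordSK _)).
have Ld := @expn_cube_gt0 R d _ (ltn0Sn L).
rewrite /cavg -mulrBl normrM [X in _ * X]ger0_norm ?invr_ge0//.
rewrite ler_pdivrMr// [X in _ - X](reindex_inj rot_inj) -sumrB.
have -> : 2 * K / L.+1%:R * (L.+1 ^ d)%:R =
    \sum_(v : {ffun 'I_d -> 'I_L.+1}) 2 * K * (v i == ord_max)%:R.
  by rewrite -(sum_face L i) -mulr_sumr; field; rewrite nat1r pnatr_eq0.
apply: le_trans (ler_norm_sum _ _ _) (ler_sum _ _) => v _.
case: (eqVneq (v i) ord_max) => vi /=.
  rewrite mulr1 (le_trans (ler_normB _ _))// mulr_natl mulr2n lerD//.
rewrite mulr0 (_ : x + unitv i + vec v = x + vec (rot v)) ?subrr ?normr0//.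
apply/rowP => j; rewrite !mxE ffunE eqxx/=.
have vL : (v i < L)%N by have := ltn_ord (v i); move: vi; rewrite -val_eqE /=; lia.
case: (eqVneq j i) => [->|_] /=; last by rewrite addr0.
by rewrite modn_small ?ltnS//; lia.
Qed.

(** Once the averages are exchanged, the small one acts on [cavg L F], whose gradient is at most
    [2 * K / L]. *)
Lemma cavg_cavg_near F (K : R) L m x : (0 < L)%N -> (0 < m)%N -> 0 <= K ->
  (forall z, `|F z| <= K) ->
  `|cavg L (cavg m F) x - cavg L F x| <= (2 * d * m)%:R * (2 * K / L%:R).
Proof.
move=> L0 m0 K0 FK; rewrite cavgC; apply: cavg_near => // [|z i _].
  by rewrite divr_ge0// mulr_ge0.
exact: cavg_grad_bounded.
Qed.

Lemma sqr_cavg_le F n x : (0 < n)%N -> cavg n F x ^+ 2 <= cavg n (fun z => F z ^+ 2) x.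
Proof.
move=> n0; set c := cavg n F x.
have : 0 <= cavg n (fun z => (F z - c) ^+ 2) x.
  by rewrite divr_ge0// sumr_ge0// => v _; exact: sqr_ge0.
have -> : cavg n (fun z => (F z - c) ^+ 2) x =
    cavg n (fun z => F z ^+ 2) x - c ^+ 2.
  have -> : c ^+ 2 = cavg n (fun z => 2 * c * F z - c ^+ 2) x.
    rewrite cavgB cavg_cst//.
    have -> : cavg n (fun z => 2 * c * F z) x = 2 * c * c.
      by rewrite {1}/cavg -mulr_sumr -mulrA.
    by ring.
  rewrite -cavgB; congr (cavg n _ x); apply/funext => z; ring.
by rewrite subr_ge0.
Qed.

Lemma normr_cavg_bounded F (K : R) n x : (0 < n)%N -> (forall z, `|F z| <= K) ->
  `|cavg n F x| <= K.
Proof.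
move=> n0 FK; rewrite (le_trans (normr_cavg_le _ _ _))//.
by rewrite -[leRHS](cavg_cst K x n0); apply: cavg_le.
Qed.

End Folner.

Section Bounded.
Context (R : realType) (dsp : measure_display) (Om : measurableType dsp)
  (P : probability Om R).
Implicit Types (f g : Om -> R) (K : R).

(** Bounded everywhere: a class stable under the operations below, on which real-valued integrals
    are linear with no further integrability condition. *)
Definition bdd f := measurable_fun setT f /\ exists K, forall w, `|f w| <= K.

Lemma bdd_integrable f : bdd f -> P.-integrable setT (EFin \o f).
Proof.
move=> [mf [K fK]]; apply: measurable_bounded_integrable => //.
  by apply: (@le_lt_trans _ _ 1%E); [exact: probability_le1|exact: ltry].
exists K; split; first exact: num_real.
by move=> M KM w _ /=; exact: le_trans (fK w) (ltW KM).
Qed.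

Lemma bdd_cst K : bdd (fun=> K).
Proof. by split; [exact: measurable_cst|exists `|K|]. Qed.

Lemma bddD f g : bdd f -> bdd g -> bdd (fun w => f w + g w).
Proof.
move=> [mf [K fK]] [mg [M gM]]; split; first exact: measurable_funD.
by exists (K + M) => w; rewrite (le_trans (ler_normD _ _))// lerD.
Qed.

Lemma bddM f g : bdd f -> bdd g -> bdd (fun w => f w * g w).
Proof.
move=> [mf [K fK]] [mg [M gM]]; split; first exact: measurable_funM.
by exists (K * M) => w; rewrite normrM ler_pM.
Qed.

Lemma bddZ K g : bdd g -> bdd (fun w => K * g w).
Proof. by move=> bg; apply: bddM => //; exact: bdd_cst. Qed.

Lemma bddB f g : bdd f -> bdd g -> bdd (fun w => f w - g w).
Proof.
move=> bf bg; have := bddD bf (bddZ (-1) bg).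
by under eq_fun do rewrite mulN1r.
Qed.

Lemma bddX f : bdd f -> bdd (fun w => f w ^+ 2).
Proof. by move=> bf; under eq_fun do rewrite expr2; exact: bddM. Qed.

Lemma bdd_norm f : bdd f -> bdd (fun w => `|f w|).
Proof.
move=> [mf [K fK]]; split; first exact: measurableT_comp.
by exists K => w; rewrite normr_id.
Qed.

Lemma bdd_max f c : bdd f -> bdd (fun w => Num.max (f w) c).
Proof.
move=> [mf [K fK]]; split; first exact: measurable_maxr.
exists (K + `|c|) => w; rewrite maxEle; case: ifP => _.
  by rewrite lerDr (le_trans _ (fK w)).
by rewrite ler_wpDr.
Qed.

Local Notation I := (Rintegral P setT).

Lemma bdd_IntD f g : bdd f -> bdd g -> I (fun w => f w + g w) = I f + I g.
Proof. by move=> bf bg; rewrite RintegralD//; exact: bdd_integrable. Qed.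

Lemma bdd_IntZ K f : bdd f -> I (fun w => K * f w) = K * I f.
Proof. by move=> bf; rewrite RintegralZl//; exact: bdd_integrable. Qed.

Lemma Int_cst K : I (fun=> K) = K.
Proof.
rewrite Rintegral_cst//.
have -> : fine (P setT) = 1 by rewrite probability_setT.
by rewrite mulr1.
Qed.

Lemma bdd_Int_le f g : bdd f -> bdd g -> (forall w, f w <= g w) -> I f <= I g.
Proof. by move=> bf bg fg; apply: le_Rintegral => //; exact: bdd_integrable. Qed.

Lemma bdd_IntE f : bdd f -> (\int[P]_w (f w)%:E)%E = (I f)%:E.
Proof.
move=> bf; rewrite fineK//.
by apply: integrable_fin_num => //; exact: (bdd_integrable bf).
Qed.

Lemma bdd_cvg_Int (u : nat -> Om -> R) (l K : R) :
  (forall j, measurable_fun setT (u j)) -> (forall j w, `|u j w| <= K) ->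
  {ae P, forall w, u j w @[j --> \oo] --> l} ->
  I (u j) @[j --> \oo] --> l.
Proof.
move=> mu uK ul.
have bu j : bdd (u j) by split => //; exists K.
have [] := @dominated_convergence _ _ _ P setT measurableT (fun j => EFin \o u j)
  (cst l%:E) (cst K%:E).
- by move=> j; exact/measurable_EFinP.
- exact: measurable_cst.
- apply: filterS ul => w cv _; by apply: cvg_EFin; [exact: nearW|exact: cv].
- exact: finite_measure_integrable_cst.
- by apply: aeW => w j _; rewrite lee_fin.
move=> _ _; rewrite integral_cst//.
have -> : (l%:E * P setT = l%:E)%E by rewrite probability_setT mule1.
move=> cv.
have -> : (fun j => I (u j)) = fine \o (fun j => \int[P]_w (u j w)%:E)%E by [].
exact: fine_cvg cv.
Qed.

End Bounded.

(** * The mean ergodic theorem for bounded functions *)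

Section MeanErgodic.
Context (R : realType) (dsp : measure_display) (Om : measurableType dsp)
  (P : probability Om R) (d : nat) (S : 'rV[int]_d -> Om -> Om).
Local Notation Zd := 'rV[int]_d.
Hypotheses (S0 : forall w, S 0 w = w)
  (SD : forall x y w, S (x + y) w = S x (S y w))
  (mS : forall x, measurable_fun setT (S x))
  (PS : forall x (A : set Om), measurable A -> P (S x @^-1` A) = P A)
  (erg : forall A : set Om, measurable A ->
     (forall i, S (unitv i) @^-1` A = A) -> P A = 0%E \/ P A = 1%E).
Local Notation I := (Rintegral P setT).
Local Notation oavg := (oavg S).

Lemma bdd_shift (f : Om -> R) x : bdd f -> bdd (fun w => f (S x w)).
Proof.
by move=> [mf [K fK]]; split; [exact: (measurable_shift mS)|exists K].
Qed.

Lemma bdd_Int_shift (f : Om -> R) x : bdd f -> I (fun w => f (S x w)) = I f.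
Proof.
move=> bf; have [_ [K fK]] := bf.
(* The change of variables was stated for non-negative functions; adding the bound [K] reduces to
   them. *)
have bK := bdd_cst Om K.
have IK g : bdd g -> I (fun w => g w + K) = I g + K.
  by move=> bg; rewrite bdd_IntD// Int_cst.
apply: (@addIr _ K); rewrite -!IK//; last exact: bdd_shift.
rewrite /Rintegral (@ge0_integral_shift _ _ _ P _ _ mS PS (fun w => f w + K))//.
  by apply: measurable_funD; [case: bf|exact: measurable_cst].
by move=> w; have := fK w; rewrite ler_norml; lra.
Qed.

Lemma bdd_oavg n (f : Om -> R) x : (0 < n)%N -> bdd f -> bdd (oavg n f x).
Proof.
move=> n0 [mf [K fK]]; split; first exact: measurable_oavg.
by exists K => w; apply: normr_cavg_bounded.
Qed.

Lemma bdd_Int_sum (T : finType) (h : T -> Om -> R) : (forall v, bdd (h v)) ->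
  bdd (fun w => \sum_v h v w) /\ I (fun w => \sum_v h v w) = \sum_v I (h v).
Proof.
move=> bh; elim: (index_enum T) => [|v s [bs IH]].
  under eq_fun do rewrite big_nil; rewrite big_nil Int_cst; split=> //.
  exact: bdd_cst.
under eq_fun do rewrite big_cons; rewrite big_cons -IH; split; first exact: bddD.
exact: bdd_IntD.
Qed.

Lemma bdd_Int_oavg n (f : Om -> R) x : (0 < n)%N -> bdd f -> I (oavg n f x) = I f.
Proof.
move=> n0 bf; rewrite /oavg /cavg; under eq_fun do rewrite mulrC.
have [bs IS] := bdd_Int_sum (fun v : {ffun 'I_d -> 'I_n} => bdd_shift (x + vec v) bf).
rewrite bdd_IntZ// IS (eq_bigr (fun=> I f)); last by move=> v _; exact: bdd_Int_shift.
rewrite sumr_const card_cube -[X in _ * X]mulr_natl mulrA mulVf ?mul1r//.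
by rewrite gt_eqF// expn_cube_gt0.
Qed.

Definition energy (f : Om -> R) : R := I (fun w => f w ^+ 2).

Lemma energy_ge0 (f : Om -> R) : 0 <= energy f.
Proof. by apply: Rintegral_ge0 => w _; exact: sqr_ge0. Qed.

Lemma energy_oavg_le n (f : Om -> R) : (0 < n)%N -> bdd f ->
  energy (oavg n f 0) <= energy f.
Proof.
move=> n0 bf; rewrite -[leRHS](bdd_Int_oavg 0 n0 (bddX bf)).
apply: bdd_Int_le; [exact/bddX/bdd_oavg|exact/bdd_oavg/bddX|].
by move=> w; exact: sqr_cavg_le.
Qed.

Lemma energy_close (f g : Om -> R) K c : bdd f -> bdd g -> 0 <= K ->
  (forall w, `|f w| <= K) -> (forall w, `|g w| <= K) ->
  (forall w, `|f w - g w| <= c) -> energy f <= energy g + 2 * K * c.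
Proof.
move=> bf bg K0 fK gK fgc; rewrite -[2 * K * c](Int_cst P) -bdd_IntD//; last 2 first.
- exact: bddX.
- exact: bdd_cst.
apply: bdd_Int_le => [||w]; [exact: bddX|by apply: bddD; [exact: bddX|exact: bdd_cst]|].
rewrite -lerBlDl subr_sqr mulrC (le_trans (ler_norm _))// normrM.
rewrite ler_pM// (le_trans (ler_normD _ _))//.
by rewrite mulr_natl mulr2n lerD.
Qed.

Lemma oavg_oavg_near (f : Om -> R) (K : R) L m w : (0 < L)%N -> (0 < m)%N -> 0 <= K ->
  (forall w, `|f w| <= K) ->
  `|oavg L (oavg m f 0) 0 w - oavg L f 0 w| <= (2 * d * m)%:R * (2 * K / L%:R).
Proof.
move=> L0 m0 K0 fK; rewrite {1}/oavg.
under [X in cavg _ X]eq_fun do rewrite oavg_shift0//.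
by apply: cavg_cavg_near.
Qed.

Section BoundedMean.
Variables (f : Om -> R) (K : R).
Hypotheses (bf : bdd f) (K0 : 0 <= K) (fK : forall w, `|f w| <= K).

Let e n := energy (oavg n f 0).
(** The minimal squared norm, as in the proof of von Neumann's theorem by elements of minimal norm;
    the aim is [mu <= 0] when the mean vanishes. *)
Let mu := inf [set e n | n in [set n | (0 < n)%N]].

Let mu_has_inf : has_inf [set e n | n in [set n | (0 < n)%N]].
Proof.
split; first by exists (e 1), 1%N.
by exists 0 => _ [n _ <-]; exact: energy_ge0.
Qed.

Let mu_le n : (0 < n)%N -> mu <= e n.
Proof. by move=> n0; apply: ge_inf; [case: mu_has_inf|exists n]. Qed.

Let absorb (a b c : R) : 0 <= c -> (forall L, (0 < L)%N -> a <= b + c / L%:R) -> a <= b.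
Proof.
move=> c0 H; apply/ler_addgt0Pr => eps eps0.
pose L := (Num.truncn (c / eps)).+1.
apply: le_trans (H L isT) _; rewrite lerD2l ler_pdivrMr ?ltr0n//.
rewrite mulrC -ler_pdivrMr// ltW//.
by rewrite truncnS_gt.
Qed.

Let avgK n w : (0 < n)%N -> `|oavg n f 0 w| <= K.
Proof. by move=> n0; apply: normr_cavg_bounded. Qed.

(** [oavg L f] is close to [oavg L (oavg m f)], and averaging does not increase energy. The error is
    [2 * K] times the distance [2 d m * (2 K / L)]. Consequently the infimum [mu] is a limit. *)
Let energy_mono m L : (0 < m)%N -> (0 < L)%N ->
  e L <= e m + 8 * d%:R * K ^+ 2 * m%:R / L%:R.
Proof.
move=> m0 L0; have bm := bdd_oavg 0 m0 bf.
apply: le_trans (energy_close (bdd_oavg 0 L0 bf) (bdd_oavg 0 L0 bm) K0 _ _ _) _.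
- by move=> w; exact: avgK.
- by move=> w; apply: normr_cavg_bounded => // z; exact: avgK.
- by move=> w; rewrite distrC; apply: (oavg_oavg_near _ L0 m0 K0 fK).
rewrite lerD ?energy_oavg_le// le_eqVlt; apply/orP; left; apply/eqP.
by rewrite !natrM; field; rewrite pnatr_eq0 -lt0n.
Qed.

Lemma energy_limit eps : 0 < eps -> exists L0, forall L, (L0 <= L)%N ->
  e L <= mu + eps.
Proof.
move=> eps0; have eps20 : 0 < eps / 2 by rewrite divr_gt0.
have [_ [m m0 <-] em] := inf_adherent eps20 mu_has_inf.
have /= c0 : 0 <= 8 * d%:R * K ^+ 2 * m%:R by rewrite !mulr_ge0 ?sqr_ge0.
set c := 8 * _ * _ * _ in c0.
exists (Num.truncn (c / (eps / 2))).+1 => L LL.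
have L0 : (0 < L)%N by exact: leq_trans LL.
apply: le_trans (energy_mono m0 L0) _.
have : c / L%:R <= eps / 2.
  rewrite ler_pdivrMr ?ltr0n// mulrC -ler_pdivrMr//.
  by rewrite (le_trans (ltW (truncnS_gt _)))// ler_nat.
by rewrite -/c; move: em; rewrite -/mu; lra.
Qed.

(* Parallelogram law: the midpoint has energy at least [mu], because averaging
   it over a large cube [L] brings it close to [oavg L f]. *)
Lemma energy_diff m n : (0 < m)%N -> (0 < n)%N ->
  energy (fun w => oavg m f 0 w - oavg n f 0 w) <= 2 * e m + 2 * e n - 4 * mu.
Proof.
move=> m0 n0; have bm := bdd_oavg 0 m0 bf; have bn := bdd_oavg 0 n0 bf.
pose g w := 2^-1 * (oavg m f 0 w + oavg n f 0 w).
have bg : bdd g by apply/bddZ/bddD.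
have gK w : `|g w| <= K.
  have := avgK w m0; have := avgK w n0; rewrite !ler_norml /g; lra.
have mug : mu <= energy g.
  apply: (@absorb _ _ (8 * d%:R * K ^+ 2 * (m + n)%:R)).
    by rewrite !mulr_ge0 ?sqr_ge0.
  move=> L L0; apply: le_trans (mu_le L0) _.
  apply: le_trans (energy_close (bdd_oavg 0 L0 bf) (bdd_oavg 0 L0 bg) K0 _ _ _) _.
  - by move=> w; exact: avgK.
  - by move=> w; apply: normr_cavg_bounded.
  - move=> w; have gE : oavg L g 0 w =
        2^-1 * (oavg L (oavg m f 0) 0 w + oavg L (oavg n f 0) 0 w).
      by rewrite /oavg /cavg -mulrDl -big_split/= mulrA mulr_sumr.
    have := oavg_oavg_near w L0 m0 K0 fK; have := oavg_oavg_near w L0 n0 K0 fK.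
    rewrite gE; set a := oavg L f 0 w; set b := oavg L _ 0 w; set c := oavg L _ 0 w.
    have -> : (2 * d * m)%:R * (2 * K / L%:R) = m%:R * (4 * d%:R * K / L%:R) :> R.
      by rewrite !natrM; ring.
    have -> : (2 * d * n)%:R * (2 * K / L%:R) = n%:R * (4 * d%:R * K / L%:R) :> R.
      by rewrite !natrM; ring.
    move=> h1 h2; instantiate (1 := (m + n)%:R * (4 * d%:R * K / L%:R)).
    move: h1 h2; rewrite natrD !ler_norml; lra.
  rewrite lerD ?energy_oavg_le// le_eqVlt; apply/orP; left; apply/eqP.
  by field; rewrite pnatr_eq0 -lt0n.
have lhs : I (fun w => (oavg m f 0 w - oavg n f 0 w) ^+ 2 + 4 * g w ^+ 2) =
    energy (fun w => oavg m f 0 w - oavg n f 0 w) + 4 * energy g.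
  rewrite bdd_IntD ?bdd_IntZ//; first exact/bddX.
    exact/bddX/bddB.
  exact/bddZ/bddX.
have rhs : I (fun w => 2 * oavg m f 0 w ^+ 2 + 2 * oavg n f 0 w ^+ 2) = 2 * e m + 2 * e n.
  rewrite bdd_IntD ?bdd_IntZ//; [exact/bddX|exact/bddX|exact/bddZ/bddX|exact/bddZ/bddX].
have para : energy (fun w => oavg m f 0 w - oavg n f 0 w) + 4 * energy g = 2 * e m + 2 * e n.
  rewrite -lhs -rhs; congr Rintegral; apply/funext => w; rewrite /g; lra.
by rewrite -para; move: mug; lra.
Qed.

(** Near-minimal energies make the averages Cauchy in L^2 by [energy_diff]; a geometric rate makes
    their increments summable in L^1, hence almost surely. *)
Lemma cvg_subsequence : exists2 N : nat -> nat, (forall j, (j < N j)%N /\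
    e (N j) <= mu + 16^-1 ^+ j) &
  {ae P, forall w, cvgn (fun j => oavg (N j) f 0 w)}.
Proof.
have [N NP] : {N : nat -> nat & forall j, forall L, (N j <= L)%N -> e L <= mu + 16^-1 ^+ j}.
  apply: (@choice _ _ (fun j n => forall L, (n <= L)%N -> e L <= mu + 16^-1 ^+ j)) => j.
  by apply: energy_limit; rewrite exprn_gt0.
pose M j := maxn (N j) j.+1; have M0 j : (0 < M j)%N by rewrite leq_max orbT.
exists M => [j|]; first by split; [rewrite leq_max ltnSn orbT|apply: NP; rewrite leq_maxl].
pose h j w := `|oavg (M j.+1) f 0 w - oavg (M j) f 0 w|.
have bdh j : bdd (fun w => oavg (M j.+1) f 0 w - oavg (M j) f 0 w).
  by apply: bddB; exact: bdd_oavg.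
have hint j : (\int[P]_w (h j w)%:E <= (5 * 4^-1 ^+ j)%:E)%E.
  rewrite (bdd_IntE P (bdd_norm (bdh j))) lee_fin.
  have ed := energy_diff (M0 j.+1) (M0 j).
  have e1 := NP j.+1 (M j.+1) (leq_maxl _ _); have e0 := NP j (M j) (leq_maxl _ _).
  (* [s ^+ 2] is [16^-1 ^+ j], so the increment has energy at most [4 * s ^+ 2]. Then
     [|a| <= s + a^2 / s] gives an L^1 norm of at most [s + 4 * s]. *)
  pose s : R := 4^-1 ^+ j; have s0 : 0 < s by rewrite exprn_gt0.
  have sE : 16^-1 ^+ j = s ^+ 2.
    by rewrite /s exprAC; congr (_ ^+ _); field.
  have s1 : 0 < s^-1 by rewrite invr_gt0.
  have : I (h j) <= I (fun w => s + s^-1 * (oavg (M j.+1) f 0 w - oavg (M j) f 0 w) ^+ 2).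
    apply: bdd_Int_le => [||w]; first exact: bdd_norm.
      by apply: bddD; [exact: bdd_cst|exact/bddZ/bddX].
    rewrite /h; set a := _ - _; rewrite -real_normK ?num_real//.
    have [as_|sa] := leP `|a| s.
      by rewrite (le_trans as_)// lerDl mulr_ge0 ?sqr_ge0// ltW.
    rewrite -[leLHS]add0r lerD ?(ltW s0)// expr2 mulrA -{1}[`|a|]mul1r.
    rewrite ler_wpM2r// mulrC ler_pdivlMr// mul1r ltW//.
  move/le_trans; apply.
  rewrite bdd_IntD ?bdd_IntZ ?Int_cst; [|exact/bddX|exact: bdd_cst|exact/bddZ/bddX].
  rewrite -/s -[X in _ <= X](_ : s + s^-1 * (4 * s ^+ 2) = _); last first.
    by field; rewrite gt_eqF.
  rewrite lerD2l ler_wpM2l ?(ltW s1)// (le_trans ed)//.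
  move: e1 e0; rewrite exprS sE; have := sqr_ge0 s; lra.
have mh j : measurable_fun setT (h j) by have [] := bdd_norm (bdh j).
have h0 j w : 0 <= h j w by exact: normr_ge0.
have r01 : 0 <= (4^-1 : R) < 1 by rewrite invr_ge0 ler0n/= invf_lt1// ltr1n.
have := ae_summable mh h0 (ler0n R 5) r01 hint.
apply: filterS => w cvh.
have := @normed_cvg _ _ (fun j => oavg (M j.+1) f 0 w - oavg (M j) f 0 w) cvh.
have -> : series (fun j => oavg (M j.+1) f 0 w - oavg (M j) f 0 w) =
    (fun j => oavg (M j) f 0 w - oavg (M 0) f 0 w).
  apply/funext => j; rewrite /series/= telescope_sumr//.
move=> cvB; have -> : (fun j => oavg (M j) f 0 w) =
    (fun j => oavg (M j) f 0 w - oavg (M 0) f 0 w) \+ cst (oavg (M 0) f 0 w).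
  by apply/funext => j /=; rewrite subrK.
by apply: is_cvgD => //; exact: is_cvg_cst.
Qed.

Hypothesis If0 : I f = 0.

(** The event that the limsup lies at or below [- dl] is invariant, so it has probability 0 or 1.
    Probability 1 is impossible, since every [u j] has mean 0. *)
Lemma ae_limsup_ge0 (N : nat -> nat) (dl : R) : (forall j, (j < N j)%N) -> 0 < dl ->
  {ae P, forall w, forall J, exists2 j, (J <= j)%N & - dl <= oavg (N j) f 0 w}.
Proof.
move=> Nj dl0; pose u j := oavg (N j) f 0.
have N0 j : (0 < N j)%N by exact: leq_ltn_trans (Nj j).
have bu j : bdd (u j) by exact: bdd_oavg.
(* [B] is the event that the limsup of [u j] is at most [- dl]; it is strictly
   invariant because [f] is bounded and [N j] tends to infinity. *)
pose B := \bigcap_m \bigcup_J \bigcap_(j in [set j | (J <= j)%N])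
  [set w | dl - m.+1%:R^-1 < - u j w].
have mB : measurable B.
  apply: bigcap_measurable => // m _; apply: bigcup_measurable => J _.
  apply: bigcap_measurable; first by exists J => /=.
  move=> j _; apply: measurable_gt_cst.
  by apply: measurableT_comp => //; case: (bu j).
have near_inv j w i : `|u j (S (unitv i) w) - u j w| <= 2 * K / (N j)%:R.
  rewrite /u oavg_shift//; rewrite -[in X in _ - X](S0 w) oavg_shift//.
  by rewrite !add0r -[unitv i]add0r; exact: cavg_grad_bounded.
(* A shift eventually costs no more than the gap between two consecutive tolerances, so the
   condition of index [m.+1] at one point gives that of index [m] at the other. *)
have small (m : nat) : exists J, forall j, (J <= j)%N ->
    2 * K / (N j)%:R <= m.+1%:R^-1 - m.+2%:R^-1.
  set c := _ - _; have c0 : 0 < c by rewrite subr_gt0 ltf_pV2 ?posrE// ltr_nat.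
  exists (Num.truncn (2 * K / c)).+1 => j jJ.
  rewrite ler_pdivrMr ?ltr0n// [leRHS]mulrC -ler_pdivrMr//.
  by rewrite (le_trans (ltW (truncnS_gt _)))// ler_nat (leq_trans jJ)// ltnW.
have invB i : S (unitv i) @^-1` B = B.
  apply/seteqP; split => w /= Bw m _.
    have [J _ HJ] := Bw m.+1 Logic.I; have [J' HJ'] := small m.
    exists (maxn J J') => // j /=; rewrite geq_max => /andP[Jj J'j].
    have h4 : dl - m.+2%:R^-1 < - u j (S (unitv i) w) := HJ j Jj.
    change (dl - m.+1%:R^-1 < - u j w).
    have := near_inv j w i; rewrite ler_norml => /andP[h2 h3].
    move: h4 (HJ' j J'j); move: (m.+1%:R^-1) (m.+2%:R^-1) => p q h4 h1; lra.
  have [J _ HJ] := Bw m.+1 Logic.I; have [J' HJ'] := small m.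
  exists (maxn J J') => // j /=; rewrite geq_max => /andP[Jj J'j].
  have h4 : dl - m.+2%:R^-1 < - u j w := HJ j Jj.
  change (dl - m.+1%:R^-1 < - u j (S (unitv i) w)).
  have := near_inv j w i; rewrite ler_norml => /andP[h2 h3].
  move: h4 (HJ' j J'j); move: (m.+1%:R^-1) (m.+2%:R^-1) => p q h4 h1; lra.
have PB : P B = 0%E.
  have [//|PB1] := erg mB invB; exfalso.
  (* On [B] the truncated sequence is eventually constant, so dominated convergence gives its
     integrals the limit [- dl / 2]; yet they are at least those of [u j], which are 0. *)
  pose v j w := Num.max (u j w) (- dl / 2).
  have vK j w : `|v j w| <= K + dl.
    have uKj : `|u j w| <= K by exact: avgK.
    move: uKj; rewrite /v maxEle !ler_norml => /andP[h1 h2]; case: ifP => _; lra.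
  have bv j : bdd (v j) by exact: bdd_max.
  have cv : I (v j) @[j --> \oo] --> - dl / 2.
    apply: (bdd_cvg_Int _ vK) => [j|]; first by case: (bv j).
    exists (~` B); split.
    - exact: measurableC.
    - by rewrite probability_setC// PB1 subee.
    - move=> w; apply: contra_not => Bw.
      have [m mdl] : exists m : nat, m.+1%:R^-1 < dl / 2.
        exists (Num.truncn (2 / dl)); rewrite invf_plt ?posrE ?divr_gt0//.
        by rewrite invf_div truncnS_gt.
      have [J _ HJ] : (\bigcup_J \bigcap_(j in [set j | (J <= j)%N])
        [set w | dl - m.+1%:R^-1 < - u j w]) w by exact: Bw.
      apply: cvg_near_cst; exists J => // j /= Jj.
      have h : dl - m.+1%:R^-1 < - u j w := HJ j Jj.
      rewrite /v max_r//; move: h mdl; move: (m.+1%:R^-1) => p; lra.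
  have : 0 <= - dl / 2.
    rewrite -(cvg_lim _ cv)//; apply: limr_ge; first exact: cvgP cv.
    apply: nearW => j; rewrite -If0 -(bdd_Int_oavg 0 (N0 j) bf).
    apply: bdd_Int_le => [||w]; [exact: (bu j)|exact: (bv j)|].
    by rewrite le_max lexx.
  by apply/negP; rewrite -ltNge; lra.
exists B; split => // w; rewrite /= -existsNE => -[J HJ].
move=> m _; exists J => // j /= Jj.
have : ~ (- dl <= u j w) by move=> h; apply: HJ; exists j.
have : 0 < m.+1%:R^-1 :> R by rewrite invr_gt0.
move=> m0 /negP; rewrite -ltNge => h.
change (dl - m.+1%:R^-1 < - u j w).
by move: m0; move: (m.+1%:R^-1) => p; lra.
Qed.

(** A one-sided bound suffices because the mean is zero: the almost sure limit along the subsequence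
    is non-negative, so negative parts tend to 0 in L^1, and the L^1 norm is twice the mean of the
    negative part. *)
Lemma mean_ergodic_bounded eps : 0 < eps ->
  exists L0, forall L, (L0 <= L)%N -> e L <= eps.
Proof.
move=> eps0; suff mu0 : mu <= 0.
  have [L0 HL0] := energy_limit eps0; exists L0 => L LL.
  by have := HL0 L LL; move: mu0; lra.
have [N NP aecvg] := cvg_subsequence.
have Nj j : (j < N j)%N by case: (NP j).
have N0 j : (0 < N j)%N by exact: leq_ltn_trans (Nj j).
pose u j := oavg (N j) f 0.
have bu j : bdd (u j) by exact: bdd_oavg.
have uK j w : `|u j w| <= K by exact: avgK.
pose v j w := Num.max (- u j w) 0.
have bv j : bdd (v j).
  by apply: bdd_max; have := bddZ (-1) (bu j); under eq_fun do rewrite mulN1r.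
have cv : I (v j) @[j --> \oo] --> (0 : R).
  have vK j w : `|v j w| <= K.
    by rewrite /v maxEle; have := uK j w; rewrite !ler_norml; case: ifP => _; lra.
  apply: (bdd_cvg_Int _ vK) => [j|]; first by case: (bv j).
  have : {ae P, forall w, forall r : nat, forall J, exists2 j, (J <= j)%N &
      - r.+1%:R^-1 <= u j w}.
    apply/ae_foralln => r; apply: ae_limsup_ge0 => //.
  apply: filterS2 aecvg => w cu limH.
  have [l ul] : exists l : R, u j w @[j --> \oo] --> l by exact/cvg_ex.
  have l0 : 0 <= l.
    rewrite leNgt; apply/negP => l0.
    pose r := Num.truncn (2 / - l).
    have rl : r.+1%:R^-1 < - l / 2.
      rewrite invf_plt ?posrE ?divr_gt0 ?oppr_gt0//.
      by rewrite invf_div truncnS_gt.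
    have [J _ HJ] := cvgr_lt l ul (l / 2) ltac:(lra).
    have [j Jj uj] := limH r J.
    have h : u j w < l / 2 := HJ j Jj.
    by move: h uj rl; move: (r.+1%:R^-1) => p; lra.
  apply/cvgrPdist_le => e0 e00.
  have [J _ HJ] := cvgr_gt l ul (l - e0) ltac:(lra).
  exists J => // j /= Jj; have := HJ j Jj; rewrite /= /v sub0r normrN => h.
  rewrite ger0_norm ?le_max ?lexx ?orbT// ge_max (ltW e00) andbT; lra.
(* Uses [u^2 <= K * |u|] and [|u| = u + 2 * v], where [u j] integrates to 0. *)
have ele j : e (N j) <= 2 * K * I (v j).
  rewrite -bdd_IntZ//.
  have -> : I (fun w => 2 * K * v j w) = I (fun w => K * (u j w + 2 * v j w)).
    rewrite !bdd_IntZ ?bdd_IntD ?bdd_IntZ//; [|exact: bddZ|apply: bddD => //; exact: bddZ].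
    by rewrite [I (u j)](bdd_Int_oavg 0 (N0 j) bf) If0; ring.
  apply: bdd_Int_le => [||w]; first exact: (bddX (bu j)).
    by apply/bddZ/bddD => //; exact: bddZ.
  have -> : u j w + 2 * v j w = `|u j w|.
    by rewrite /v maxEle; case: ifP => h; [rewrite ger0_norm|rewrite ler0_norm]; lra.
  have -> : oavg (N j) f 0 w ^+ 2 = `|u j w| * `|u j w|.
    by rewrite -expr2 real_normK ?num_real.
  by rewrite ler_wpM2r.
have cv2 : (2 * K * I (v j)) @[j --> \oo] --> (0 : R).
  by rewrite -[0](mulr0 (2 * K)); apply: cvgMr.
rewrite -(cvg_lim _ cv2)//; apply: limr_ge; first exact: cvgP cv2.
by apply: nearW => j; apply: le_trans (ele j); exact: mu_le.
Qed.

End BoundedMean.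

End MeanErgodic.


(** * Sublinearity of cocycles *)

Lemma powR_add3 (R : realType) (q a b c : R) : 0 <= q -> 0 <= a -> 0 <= b -> 0 <= c ->
  (a + b + c) `^ q <= 3 `^ q * (a `^ q + b `^ q + c `^ q).
Proof.
move=> q0 a0 b0 c0; pose m := Num.max a (Num.max b c).
have abc : a + b + c <= 3 * m.
  have : a <= m by rewrite /m le_max lexx.
  have : b <= m by rewrite /m !le_max lexx orbT.
  have : c <= m by rewrite /m !le_max lexx !orbT.
  lra.
have mq : m `^ q <= a `^ q + b `^ q + c `^ q.
  have := powR_ge0 a q; have := powR_ge0 b q; have := powR_ge0 c q.
  by rewrite /m !maxEle; repeat case: ifP => _; lra.
have m0 : 0 <= m by rewrite /m le_max a0.
apply: (@le_trans _ _ ((3 * m) `^ q)).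
  by rewrite ge0_ler_powR ?nnegrE ?addr_ge0 ?mulr_ge0.
by rewrite powRM// ler_wpM2l ?powR_ge0.
Qed.

(** Passes from L^2 to L^q smallness for bounded functions: above the level [s] the factor
    [x^2 / s^2] exceeds 1. *)
Lemma powR_le_sqr (R : realType) (q K s x : R) : 1 <= q -> 0 < s -> 0 <= x -> x <= K ->
  x `^ q <= s `^ q + K `^ q / s ^+ 2 * x ^+ 2.
Proof.
move=> q1 s0 x0 xK; have q0 : 0 <= q by exact: le_trans q1.
have [xs|sx] := leP x s.
  rewrite (@le_trans _ _ (s `^ q))//; first by rewrite ge0_ler_powR ?nnegrE// ltW.
  by rewrite lerDl mulr_ge0 ?sqr_ge0// divr_ge0 ?powR_ge0 ?sqr_ge0.
rewrite -[leLHS]add0r lerD ?powR_ge0// (@le_trans _ _ (K `^ q))//.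
  by rewrite ge0_ler_powR ?nnegrE// (le_trans x0).
rewrite -mulrA ler_peMr ?powR_ge0// mulrC ler_pdivlMr ?exprn_gt0// mul1r.
by rewrite lerXn2r ?nnegrE// ltW.
Qed.

Section LqErgodic.
Context (R : realType) (dsp : measure_display) (Om : measurableType dsp)
  (P : probability Om R) (d : nat) (S : 'rV[int]_d -> Om -> Om).
Local Notation Zd := 'rV[int]_d.
Hypotheses (S0 : forall w, S 0 w = w)
  (SD : forall x y w, S (x + y) w = S x (S y w))
  (mS : forall x, measurable_fun setT (S x))
  (PS : forall x (A : set Om), measurable A -> P (S x @^-1` A) = P A)
  (erg : forall A : set Om, measurable A ->
     (forall i, S (unitv i) @^-1` A = A) -> P A = 0%E \/ P A = 1%E).
Local Notation oavg := (oavg S).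

Lemma measurable_norm_powR (q : R) (f : Om -> R) : measurable_fun setT f ->
  measurable_fun setT (fun w => `|f w| `^ q).
Proof.
move=> mf; apply: (measurableT_comp (measurable_powR q)).
exact: measurableT_comp.
Qed.

Lemma Lq_integrable (q : R) (f : Om -> R) : 1 <= q -> measurable_fun setT f ->
  (\int[P]_w (`|f w| `^ q)%:E < +oo)%E -> P.-integrable setT (EFin \o f).
Proof.
move=> q1 mf fin; apply/integrableP; split; first exact/measurable_EFinP.
apply: (@le_lt_trans _ _ (\int[P]_w (1 + `|f w| `^ q)%:E)%E).
  apply: ge0_int_le => //.
  - exact: measurableT_comp.
  - by apply: measurable_funD => //; exact: measurable_norm_powR.
  move=> w; have [f1|f1] := leP `|f w| 1.
    by rewrite (le_trans f1)// lerDl powR_ge0.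
  by rewrite -[leLHS]add0r lerD// le1r_powR// ltW.
rewrite ge0_intD//; try exact: measurable_norm_powR;
  try by move=> w; exact: powR_ge0.
rewrite probability_integral_cst.
by rewrite lte_add_pinfty// ltry.
Qed.

Definition tail (f : Om -> R) (n : nat) w : R := f w * \1_[set w | n%:R < `|f w|] w.

Lemma tailE f n w : tail f n w = if n%:R < `|f w| then f w else 0.
Proof.
rewrite /tail indicE; case: ifPn => nf; first by rewrite mem_set ?mulr1.
by rewrite memNset ?mulr0//=; exact/negP.
Qed.

Lemma measurable_tail f n : measurable_fun setT f -> measurable_fun setT (tail f n).
Proof.
move=> mf; apply: measurable_funM => //; apply: measurable_indic.
by apply: measurable_gt_cst; exact: measurableT_comp.
Qed.

Lemma tail_le f n w : `|tail f n w| <= `|f w|.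
Proof. by rewrite tailE; case: ifP => // _; rewrite normr0. Qed.

Lemma tail_int_cvg (q : R) (f : Om -> R) : 1 <= q -> measurable_fun setT f ->
  (\int[P]_w (`|f w| `^ q)%:E < +oo)%E ->
  ((\int[P]_w (`|tail f n w| `^ q)%:E) @[n --> \oo] --> 0)%E.
Proof.
move=> q1 mf fin; have q0 : 0 <= q by exact: le_trans q1.
have [] := @dominated_convergence _ _ _ P setT measurableT
  (fun n w => (`|tail f n w| `^ q)%:E) (cst 0%E) (fun w => (`|f w| `^ q)%:E).
- by move=> n; apply/measurable_EFinP/measurable_norm_powR/measurable_tail.
- exact: measurable_cst.
- apply: aeW => w _; apply: cvg_near_cst.
  exists (Num.truncn `|f w|).+1 => // n /= nf.
  rewrite tailE ifF ?normr0 ?powR0 ?gt_eqF ?(lt_le_trans ltr01)//.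
  apply/negbTE; rewrite -leNgt; apply: le_trans (ltW (truncnS_gt _)) _.
  by rewrite ler_nat.
- apply/integrableP; split; first exact/measurable_EFinP/measurable_norm_powR.
  by under eq_integral do rewrite gee0_abs ?lee_fin ?powR_ge0//.
- apply: aeW => w n _; rewrite gee0_abs ?lee_fin ?powR_ge0//.
  by rewrite ge0_ler_powR ?nnegrE// tail_le.
by move=> _ _; rewrite integral0.
Qed.

Lemma mean_ergodic_Lq (q : R) (f : Om -> R) : 1 <= q -> measurable_fun setT f ->
  (\int[P]_w (`|f w| `^ q)%:E < +oo)%E -> (\int[P]_w (f w)%:E = 0)%E ->
  forall dl : R, 0 < dl -> exists L0, forall L, (L0 <= L)%N ->
    (\int[P]_w (`|oavg L f 0 w| `^ q)%:E <= dl%:E)%E.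
Proof.
move=> q1 mf fin f0 dl dl0; have q0 : 0 < q by exact: lt_le_trans q1.
(* The bounded part will cost [2 * D], the tail [D] and the constant [c] at most [D]; [3 ^ q] is
   lost in splitting the sum. *)
pose D := dl / (4 * 3 `^ q).
have c3 : 0 < 3 `^ q :> R by exact: powR_gt0.
have c2 : 0 < 2 `^ q :> R by exact: powR_gt0.
have D0 : 0 < D by rewrite divr_gt0// mulr_gt0.
(* The bound 1 gives [|c| ^ q <= |c|]; the bound [D / 2 ^ q] absorbs the constant of [cavg_powR_le]
   for the tail. Taking [n >= 1] below gives [|r| <= |r| ^ q], hence [|c| <= eta]. *)
pose eta := Num.min 1 (Num.min D (D / 2 `^ q)).
have eta0 : 0 < eta by rewrite !lt_min ltr01 D0 divr_gt0.
have [n n0 tn] : exists2 n, (0 < n)%N & (\int[P]_w (`|tail f n w| `^ q)%:E <= eta%:E)%E.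
  have /fine_cvgP[[n1 _ H1] cv] := tail_int_cvg q1 mf fin.
  have [n2 _ H2] := cvgr_lt 0 cv _ eta0.
  exists (maxn n1 n2).+1 => //; set m := (maxn n1 n2).+1.
  have m1 : (n1 <= m)%N by rewrite /m; lia.
  have m2 : (n2 <= m)%N by rewrite /m; lia.
  by rewrite -(fineK (H1 m m1)) lee_fin ltW//; exact: H2.
pose r := tail f n; pose b w := f w - r w; pose c := Rintegral P setT b.
have mr : measurable_fun setT r by exact: measurable_tail.
have n1 : 1 <= n%:R :> R by rewrite ler1n.
have bn w : `|b w| <= n%:R.
  rewrite /b /r tailE; case: ifPn => h; first by rewrite subrr normr0.
  by rewrite subr0 leNgt.
have bb : bdd b by split; [exact: measurable_funB|exists n%:R].
have rq w : `|r w| <= `|r w| `^ q.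
  rewrite /r tailE; case: ifPn => h; last by rewrite normr0 powR_ge0.
  by rewrite le1r_powR// (le_trans n1)// ltW.
have rfin : (\int[P]_w (`|r w| `^ q)%:E < +oo)%E by exact: le_lt_trans tn (ltry _).
have intr := Lq_integrable q1 mr rfin.
have cE : c%:E = (- \int[P]_w (r w)%:E)%E.
  have : (\int[P]_w (f w)%:E = \int[P]_w (b w)%:E + \int[P]_w (r w)%:E)%E.
    rewrite -(integralD measurableT (bdd_integrable P bb) intr).
    by apply: eq_integral => w _; rewrite /= -EFinD subrK.
  rewrite f0 (bdd_IntE P bb) -/c.
  have := integrable_fin_num measurableT intr.
  case: (\int[P]_w (r w)%:E)%E => // x _; rewrite -EFinD => -[/esym/eqP].
  by rewrite addr_eq0 => /eqP ->.
have ceta : `|c| <= eta.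
  rewrite -lee_fin -abse_EFin cE abseN; apply: le_trans tn.
  apply: le_trans (le_abse_integral P measurableT _) _; first by case/integrableP: intr.
  apply: (@ge0_int_le _ _ _ P (fun w => `|r w|) (fun w => `|r w| `^ q)) => //.
    exact: measurableT_comp.
  exact: measurable_norm_powR.
pose g w := b w - c.
have bg : bdd g by apply: bddB => //; exact: bdd_cst.
have gK w : `|g w| <= n%:R + 1.
  rewrite /g (le_trans (ler_normB _ _))// lerD// (le_trans ceta)//.
  by rewrite /eta ge_min lexx.
have K0 : 0 <= n%:R + 1 :> R by rewrite addr_ge0.
have Ig : Rintegral P setT g = 0.
  have -> : g = (fun w => b w + -1 * c) by apply/funext => w; rewrite mulN1r.
  by rewrite bdd_IntD ?Int_cst//; [rewrite -/c; ring|exact: bdd_cst].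
pose s := D `^ q^-1; have s0 : 0 < s by exact: powR_gt0.
have sq : s `^ q = D by rewrite /s -powRrM mulVf ?gt_eqF// powRr1// ltW.
pose A := (n%:R + 1) `^ q / s ^+ 2.
have A0 : 0 < A by rewrite divr_gt0 ?powR_gt0 ?exprn_gt0// ltr_wpDl.
have [L1 HL1] := mean_ergodic_bounded S0 SD mS PS erg bg K0 gK Ig (divr_gt0 D0 A0).
exists (maxn L1 1) => L; rewrite geq_max => /andP[LL L0].
have fE w : oavg L f 0 w = oavg L g 0 w + oavg L r 0 w + c.
  rewrite -[X in _ + X](cavg_cst c (0 : Zd) L0) /oavg /cavg -!mulrDl -!big_split/=.
  by congr (_ / _); apply: eq_bigr => v _; rewrite /g /b; ring.
have mog : measurable_fun setT (oavg L g 0) by exact: measurable_oavg (proj1 bg).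
have mor : measurable_fun setT (oavg L r 0) by exact: measurable_oavg.
pose G w := D + A * oavg L g 0 w ^+ 2.
pose H w := 2 `^ q * oavg L (fun w => `|r w| `^ q) 0 w.
have mH : measurable_fun setT H.
  by apply: measurable_funM => //; apply: measurable_oavg => //; exact: measurable_norm_powR.
have H0 w : 0 <= H w by rewrite mulr_ge0 ?powR_ge0//; apply: oavg_ge0 => z; exact: powR_ge0.
have bG : bdd G by apply: bddD; [exact: bdd_cst|apply/bddZ/bddX; exact: bdd_oavg].
have G0 w : 0 <= G w by rewrite addr_ge0 ?(ltW D0)// mulr_ge0 ?sqr_ge0// ltW.
have ptw w : `|oavg L f 0 w| `^ q <= 3 `^ q * (G w + H w + eta).
  apply: (@le_trans _ _ ((`|oavg L g 0 w| + `|oavg L r 0 w| + `|c|) `^ q)).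
    rewrite ge0_ler_powR ?nnegrE ?(ltW q0)// ?addr_ge0// fE.
    by rewrite (le_trans (ler_normD _ _))// lerD2r ler_normD.
  rewrite (le_trans (powR_add3 _ _ _ _))// ?(ltW q0)// ler_wpM2l ?(ltW c3)//.
  apply: lerD; [apply: lerD|].
  - rewrite /G -sq -[oavg L g 0 w ^+ 2]real_normK ?num_real//; apply: powR_le_sqr => //.
    exact: normr_cavg_bounded.
  - exact: cavg_powR_le.
  - apply: (le_trans _ ceta); rewrite -[leRHS]powRr1//.
    have [->|cn0] := eqVneq `|c| 0; first by rewrite powRr1 // powR0 ?gt_eqF.
    apply: ger_powR => //; rewrite lt0r cn0 normr_ge0/= (le_trans ceta)//.
    by rewrite /eta ge_min lexx.
apply: (@le_trans _ _ (\int[P]_w (3 `^ q * (G w + H w + eta))%:E)%E).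
  apply: ge0_int_le => //.
  - by apply: measurable_norm_powR; exact: measurable_oavg.
  - apply: measurable_funM => //; apply: measurable_funD => //.
    by apply: measurable_funD => //; case: bG.
have mG : measurable_fun setT G by case: bG.
have mGH : measurable_fun setT (fun w => G w + H w) by exact: measurable_funD.
have GH0 w : 0 <= G w + H w by exact: addr_ge0.
have mGHe : measurable_fun setT (fun w => G w + H w + eta) by exact: measurable_funD.
have GHe0 w : 0 <= G w + H w + eta by rewrite addr_ge0// ltW.
rewrite (ge0_intZl P (ltW c3) mGHe GHe0).
rewrite (ge0_intD P mGH GH0 (@measurable_cst _ _ _ _ _ eta) (fun=> ltW eta0)).
rewrite (ge0_intD P mG G0 mH H0) probability_integral_cst.
have IG : (\int[P]_w (G w)%:E <= (2 * D)%:E)%E.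
  rewrite (bdd_IntE P bG) lee_fin /G bdd_IntD ?Int_cst ?bdd_IntZ//.
  - rewrite mulr_natl mulr2n lerD2l mulrC -ler_pdivlMr//; exact: HL1.
  - exact/bddX/bdd_oavg.
  - exact: bdd_cst.
  - exact/bddZ/bddX/bdd_oavg.
have IH : (\int[P]_w (H w)%:E <= D%:E)%E.
  rewrite /H ge0_intZl ?powR_ge0//; last 2 first.
  - by apply: measurable_oavg => //; exact: measurable_norm_powR.
  - by move=> w; apply: oavg_ge0 => z; exact: powR_ge0.
  rewrite (ge0_integral_oavg mS PS)//; last exact: measurable_norm_powR.
  apply: (@le_trans _ _ ((2 `^ q)%:E * eta%:E)%E).
    by rewrite lee_wpmul2l// lee_fin ltW.
  by rewrite -EFinM lee_fin mulrC -ler_pdivlMr// /eta !ge_min lexx !orbT.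
apply: (@le_trans _ _ ((3 `^ q)%:E * ((2 * D)%:E + D%:E + D%:E))%E).
  rewrite lee_wpmul2l ?lee_fin ?(ltW c3)// leeD ?leeD// lee_fin.
  by rewrite /eta !ge_min lexx !orbT.
rewrite -!EFinD -EFinM lee_fin /D le_eqVlt; apply/orP; left; apply/eqP.
by field; rewrite gt_eqF.
Qed.

(** [U] is quantified inside the almost sure statement, so a potential may be chosen for each [w]
    with no measurability in [w]. *)
Lemma cocycle_sublinear (q : R) (a : 'I_d -> Om -> R) : 1 <= q -> d%:R < q ->
  (forall i, measurable_fun setT (a i)) ->
  (forall i, (\int[P]_w (`|a i w| `^ q)%:E < +oo)%E) ->
  (forall i, (\int[P]_w (a i w)%:E = 0)%E) ->
  {ae P, forall w, forall U : Zd -> R,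
    (forall (x : Zd) i, U (x + unitv i) - U x = a i (S x w)) ->
    forall e : R, 0 < e -> exists k0, forall k, (k0 <= k)%N ->
    forall x : Zd, (forall j, - (2 ^ k)%:Z <= x 0 j <= (2 ^ k)%:Z) ->
    `|U x - U 0| <= e * (2 ^ k)%:R}.
Proof.
move=> q1 dq ma fin a0; have q0 : 0 < q by exact: lt_le_trans q1.
have [C C0 HC] := @morrey R d q q1 dq.
have sub i := Lq_sublinear mS PS (ma i) dq (fin i).
have sub_all : {ae P, forall w, forall (i : 'I_d) (e : R), 0 < e -> exists k0, forall k, (k0 <= k)%N ->
    forall x : Zd, (forall j, - (4 * 2 ^ k)%:Z <= x 0 j < (4 * 2 ^ k)%:Z) ->
    `|a i (S x w)| <= e * (2 ^ k)%:R}.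
  have : {ae P, forall w, forall (n : nat) (i : 'I_d), n = i -> forall (e : R), 0 < e ->
    exists k0, forall k, (k0 <= k)%N ->
    forall x : Zd, (forall j, - (4 * 2 ^ k)%:Z <= x 0 j < (4 * 2 ^ k)%:Z) ->
    `|a i (S x w)| <= e * (2 ^ k)%:R}.
    apply/ae_foralln => n; have [nd|dn] := ltnP n d; last first.
      by apply: aeW => w i ni; have := ltn_ord i; rewrite -ni ltnNge dn.
    apply: filterS (sub (Ordinal nd)) => w Hw i ni.
    by have -> : i = Ordinal nd by apply: val_inj.
  by apply: filterS => w Hw i; apply: (Hw i i).
(* The null set built below depends on the tolerance, which therefore runs through a countable
   family. *)
suff main (r : nat) : {ae P, forall w, (forall i (e : R), 0 < e -> exists k0, forall k, (k0 <= k)%N ->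
    forall x : Zd, (forall j, - (4 * 2 ^ k)%:Z <= x 0 j < (4 * 2 ^ k)%:Z) ->
    `|a i (S x w)| <= e * (2 ^ k)%:R) -> forall U : Zd -> R,
    (forall (x : Zd) i, U (x + unitv i) - U x = a i (S x w)) ->
    exists k0, forall k, (k0 <= k)%N ->
    forall x : Zd, (forall j, - (2 ^ k)%:Z <= x 0 j <= (2 ^ k)%:Z) ->
    `|U x - U 0| <= r.+1%:R^-1 * (2 ^ k)%:R}.
  have /ae_foralln all_r := main.
  apply: filterS2 all_r sub_all => w Hw sw U gU e e0.
  have [k0 Hk0] := Hw (Num.truncn e^-1) sw U gU.
  exists k0 => k kk x xB; apply: le_trans (Hk0 k kk x xB) _.
  rewrite ler_wpM2r// invf_ple ?posrE// ltW//.
  exact: truncnS_gt.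
pose e : R := r.+1%:R^-1; have e0 : 0 < e by rewrite invr_gt0.
(* Chosen so that Morrey's bound [C * eta^(1/q)] is at most [e / 2]; [C + 1] guards against
   [C = 0]. *)
pose eta := (e / (2 * (C + 1))) `^ q.
have C1 : 0 < C + 1 by rewrite ltr_wpDl.
have eta0 : 0 < eta by rewrite powR_gt0// divr_gt0// mulr_gt0.
have Ceta : C * eta `^ q^-1 <= e / 2.
  rewrite /eta -powRrM mulfV ?gt_eqF// powRr1; last by rewrite ltW// divr_gt0// mulr_gt0.
  rewrite invfM [e * _]mulrA mulrCA -[leRHS]mulr1 ler_wpM2l ?divr_ge0 ?(ltW e0)//.
  by rewrite ler_pdivrMr// mul1r lerDl.
pose c := d%:R * (4 ^ d)%:R / eta.
have c0 : 0 <= c by rewrite divr_ge0 ?mulr_ge0// ltW.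
(* The bad event for the averaging side [L]. Summing over [i] treats all directions by one use of
   the maximal inequality. *)
pose B L := [set w | exists k, eta < oavg (8 * 2 ^ k)
  (fun w => \sum_i `|oavg L (a i) 0 w| `^ q) (corner d (4 * 2 ^ k)) w].
have moq L i : measurable_fun setT (fun w => `|oavg L (a i) 0 w| `^ q).
  by apply: measurable_norm_powR; exact: measurable_oavg.
have msum L : measurable_fun setT (fun w => \sum_i `|oavg L (a i) 0 w| `^ q).
  by apply: measurable_sum => i.
have mB L : measurable (B L).
  have -> : B L = \bigcup_k [set w | eta < oavg (8 * 2 ^ k)
      (fun w => \sum_i `|oavg L (a i) 0 w| `^ q) (corner d (4 * 2 ^ k)) w].
    by apply/seteqP; split => w /= [k]; [exists k|move=> _; exists k].
  apply: bigcup_measurable => k _; apply: measurable_gt_cst.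
  exact: measurable_oavg.
have smallB (l : nat) : {L | (0 < L)%N & (P (B L) <= (l.+1%:R^-1)%:E)%E}.
  apply: cid2; pose dl : R := l.+1%:R^-1 / (c + 1).
  have dl0 : 0 < dl by rewrite divr_gt0 ?invr_gt0// ltr_wpDl.
  have [L0 HL0] := @choice _ _ (fun i n => forall L, (n <= L)%N ->
    (\int[P]_w (`|oavg L (a i) 0 w| `^ q)%:E <= dl%:E)%E)
    (fun i => mean_ergodic_Lq q1 (ma i) (fin i) (a0 i) dl0).
  exists (\max_i L0 i).+1 => //; set L := _.+1.
  have Li i : (L0 i <= L)%N by rewrite /L leqW// leq_bigmax.
  apply: le_trans (maximal_ineq SD mS PS _ _ eta0) _ => //.
    by move=> w; rewrite sumr_ge0// => i _; exact: powR_ge0.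
  under eq_integral do rewrite -sumEFin.
  rewrite ge0_integral_sum//; try (by move=> i; apply/measurable_EFinP);
    try (by move=> i w _; rewrite lee_fin powR_ge0).
  apply: (@le_trans _ _ (((4 ^ d)%:R / eta)%:E * \sum_(i < d) dl%:E)%E).
    rewrite lee_wpmul2l ?lee_fin ?divr_ge0 ?(ltW eta0)//.
    by apply: lee_sum => i _; exact: HL0.
  rewrite sumEFin sumr_const card_ord -EFinM lee_fin.
  have -> : (4 ^ d)%:R / eta * (dl *+ d) = c * dl by rewrite -mulr_natl /c; ring.
  rewrite /dl mulrA ler_pdivrMr ?ltr_wpDl// mulrC ler_wpM2l ?invr_ge0//.
  by rewrite lerDl.
pose N l := s2val (smallB l).
have N0 l : (0 < N l)%N by rewrite /N; case: (smallB l).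
have PN l : (P (B (N l)) <= (l.+1%:R^-1)%:E)%E by rewrite /N; case: (smallB l).
have null : P (\bigcap_l B (N l)) = 0%E.
  apply/eqP; rewrite eq_le measure_ge0 andbT; apply/lee_addgt0Pr => t t0.
  rewrite add0e; pose l := Num.truncn t^-1.
  apply: (@le_trans _ _ (P (B (N l)))).
    apply: le_measure; rewrite ?inE//; first exact: bigcap_measurableType.
    by move=> w Hw; exact: Hw.
  apply: le_trans (PN l) _.
  rewrite lee_fin invf_ple ?posrE// ltW//; exact: truncnS_gt.
exists (\bigcap_l B (N l)); split => //; first exact: bigcap_measurableType.
move=> w; apply: contra_notP => wB sw U gU.
have [l wl] : exists l, ~ B (N l) w.
  by apply/existsNP => H; apply: wB => l _; exact: H.
set L := N l in wl; have L0 : (0 < L)%N := N0 l.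
have gcavg z i : cavg L U (z + unitv i) - cavg L U z = oavg L (a i) 0 (S z w).
  rewrite cavg_grad oavg_shift0// /oavg; congr (cavg L _ z).
  by apply/funext => y; rewrite gU.
have UL k (x : Zd) : (forall j, - (2 ^ k)%:Z <= x 0 j <= (2 ^ k)%:Z) ->
    `|cavg L U x - cavg L U 0| <= e / 2 * (2 ^ k)%:R.
  move=> xB; apply: le_trans (HC _ k eta (ltW eta0) _ x xB) _; last first.
    by rewrite ler_wpM2r.
  move=> i; rewrite leNgt; apply/negP => lt; apply: wl; exists k.
  apply: lt_le_trans lt _; rewrite /oavg; apply: cavg_le => v.
  rewrite gcavg (bigD1 i)//= lerDl sumr_ge0// => j _; exact: powR_ge0.
(* Replacing [U] by [cavg L U] then costs at most [e / 4] at [x] and again at 0, beside the [e / 2]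
   of Morrey's inequality. *)
pose e' := e / (4 * (2 * d * L)%:R + 1).
have den0 : 0 < 4 * (2 * d * L)%:R + 1 :> R by rewrite ltr_wpDl// mulr_ge0.
have e'0 : 0 < e' by rewrite divr_gt0.
have [k0 Hk0] := @choice _ _ _ (fun i => sw i e' e'0).
(* [L <= k] forces [L < 2 ^ k], which keeps the cube of side [L] at [y] in the region where the
   increments are controlled. *)
exists (maxn L (\max_i k0 i)) => k; rewrite geq_max => /andP[Lk /bigmax_leqP kk] x xB.
have L2k : (L < 2 ^ k)%N by apply: leq_ltn_trans Lk (ltn_expl _ _).
have near (y : Zd) : (forall j, - (2 ^ k)%:Z <= y 0 j <= (2 ^ k)%:Z) ->
    `|cavg L U y - U y| <= e / 4 * (2 ^ k)%:R.
  move=> yB; apply: (@le_trans _ _ ((2 * d * L)%:R * (e' * (2 ^ k)%:R))).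
    apply: cavg_near => // [|z i zB]; first by rewrite mulr_ge0// ltW.
    rewrite gU; apply: Hk0; first exact: kk.
    move=> j; move: (zB j) (yB j) L2k; generalize (2 ^ k)%N (z 0 j) (y 0 j) L.
    by clear; lia.
  rewrite mulrA ler_wpM2r// /e' mulrA ler_pdivrMr// mulrC.
  rewrite -mulrA ler_wpM2l ?(ltW e0)//; lra.
have zB j : - (2 ^ k)%:Z <= (0 : Zd) 0 j <= (2 ^ k)%:Z by rewrite mxE oppr_le0.
have := near x xB; have := near 0 zB; have := UL k x xB.
have -> : U x - U 0 = (cavg L U x - cavg L U 0) - (cavg L U x - U x) +
  (cavg L U 0 - U 0) by ring.
move=> h1 h2 h3; rewrite (le_trans (ler_normD _ _))//.
have := ler_normB (cavg L U x - cavg L U 0) (cavg L U x - U x).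
rewrite -/e; lra.
Qed.

End LqErgodic.


(** * The quenched walk *)

Section ShiftAction.
Context (Om : Type) (d : nat) (T Tinv : 'I_d -> Om -> Om).
Hypotheses (TK : forall i, cancel (T i) (Tinv i) /\ cancel (Tinv i) (T i))
  (TC : forall i j, T i \o T j = T j \o T i).
Local Notation pw := (powT T Tinv).
(* Unqualified, [shift] denotes translation in MathComp-Analysis. *)
Local Notation S := (Defs.shift T Tinv).

Let TTC i j w : T i (T j w) = T j (T i w).
Proof. by have := congr1 (fun f => f w) (TC i j). Qed.

Let TVC i j w : T i (Tinv j w) = Tinv j (T i w).
Proof. by rewrite -[LHS](TK j).1 -TTC (TK j).2. Qed.

Let VVC i j w : Tinv i (Tinv j w) = Tinv j (Tinv i w).
Proof. by rewrite -[LHS](TK j).1 TVC (TK j).2. Qed.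

Lemma iter_comm (A : Type) (g h : A -> A) n w : (forall v, h (g v) = g (h v)) ->
  h (iter n g w) = iter n g (h w).
Proof. by move=> gh; elim: n => //= n <-. Qed.

Lemma powT_comm h i z w : (forall v, h (T i v) = T i (h v)) ->
  (forall v, h (Tinv i v) = Tinv i (h v)) -> h (pw i z w) = pw i z (h w).
Proof. by move=> hT hV; case: z => n; rewrite /powT iter_comm. Qed.

Lemma powTC i j z z' w : pw i z (pw j z' w) = pw j z' (pw i z w).
Proof. by apply: powT_comm => v; apply/esym/powT_comm. Qed.

Lemma powT_succ i z w : pw i (z + 1) w = T i (pw i z w).
Proof.
case: z => [n|[|n]]; first by rewrite -[_ + 1]/(Posz (n + 1)) addn1.
  by rewrite /= (TK i).2.
have -> : Negz n.+1 + 1 = Negz n by rewrite !NegzE; lia.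
by rewrite /= (TK i).2.
Qed.

Lemma powT_pred i z w : pw i (z - 1) w = Tinv i (pw i z w).
Proof. by rewrite -{2}[z](subrK 1) powT_succ (TK i).1. Qed.

Lemma powTD i z z' w : pw i (z + z') w = pw i z (pw i z' w).
Proof.
elim/int_ind: z => [|n IH|n IH]; first by rewrite add0r.
  by rewrite -addn1 PoszD addrAC !powT_succ IH.
by rewrite -addn1 PoszD opprD addrAC !powT_pred IH.
Qed.

Lemma shift0 w : S 0 w = w.
Proof. by rewrite /Defs.shift; elim: (enum _) => //= i s ->; rewrite mxE. Qed.

Let foldr_powTC i z (x : 'rV[int]_d) s v :
  pw i z (foldr (fun j w => pw j (x 0 j) w) v s) =
  foldr (fun j w => pw j (x 0 j) w) (pw i z v) s.
Proof. by elim: s v => //= j s IH v; rewrite powTC IH. Qed.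

Lemma shiftD x y w : S (x + y) w = S x (S y w).
Proof.
rewrite /Defs.shift; elim: (enum _) => //= i s IH; rewrite IH mxE powTD; congr (pw i _ _).
exact: foldr_powTC.
Qed.

Lemma shift_unitv i w : S (unitv i) w = T i w.
Proof.
rewrite /Defs.shift; suff H s : uniq s ->
    foldr (fun j w' => pw j (unitv i 0 j) w') w s = if i \in s then T i w else w.
  by rewrite H ?enum_uniq// mem_enum.
elim: s => //= j s IH /andP[js us]; rewrite IH// unitvE inE.
by case: (eqVneq j i) js => [->|ji] /negbTE js; rewrite ?js ?eqxx//= eq_sym (negbTE ji).
Qed.

End ShiftAction.

Section ShiftMeasure.
Context (R : realType) (dsp : measure_display) (Om : measurableType dsp)
  (P : probability Om R) (d : nat) (T Tinv : 'I_d -> Om -> Om).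
Hypotheses
  (mT : forall i, measurable_fun setT (T i) /\ measurable_fun setT (Tinv i))
  (PT : forall i (A : set Om), measurable A ->
     P (T i @^-1` A) = P A /\ P (Tinv i @^-1` A) = P A).

Let pres (g : Om -> Om) := measurable_fun setT g /\
  forall A, measurable A -> P (g @^-1` A) = P A.

Let pres_id : pres id.
Proof. by split. Qed.

Let pres_comp g h : pres g -> pres h -> pres (g \o h).
Proof.
move=> [mg Pg] [mh Ph]; split; first exact: measurableT_comp.
move=> A mA; rewrite comp_preimage Ph ?Pg//.
by rewrite -[X in measurable X]setTI; exact: mg.
Qed.

Let pres_iter n g : pres g -> pres (iter n g).
Proof. by move=> pg; elim: n => [|n IH]; [exact: pres_id|exact: (pres_comp pg IH)]. Qed.

Lemma shift_pres x : measurable_fun setT (Defs.shift T Tinv x) /\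
  forall A, measurable A -> P (Defs.shift T Tinv x @^-1` A) = P A.
Proof.
rewrite -/(pres _) /Defs.shift; elim: (enum _) => [|i s IH] /=; first exact: pres_id.
have pT : pres (T i) by split; [exact: (mT i).1|move=> A /(PT i)[]].
have pV : pres (Tinv i) by split; [exact: (mT i).2|move=> A /(PT i)[]].
apply: (@pres_comp (powT T Tinv i (x 0 i)) (fun w => foldr _ w s)) => //.
by case: (x 0 i) => n; rewrite /powT; exact: pres_iter.
Qed.

End ShiftMeasure.

Lemma dir_true d (i : 'I_d) : dir (i, true) = unitv i.
Proof. by rewrite /dir scale1r. Qed.

(** [pos] at the full length, freed from the prefix index so that it is additive under
    concatenation. *)
Definition endpos d (s : seq ('I_d * bool)) : 'rV[int]_d := \sum_(k <- s) dir k.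

Lemma pos_size d (s : seq ('I_d * bool)) n : (size s <= n)%N -> pos s n = endpos s.
Proof. by move=> sn; rewrite /pos take_oversize. Qed.

Lemma endpos_surj d (x : 'rV[int]_d) : exists s, endpos s = x.
Proof.
exists (flatten [seq nseq `|(x 0%R i : int)|%N (i, (0 <= x 0 i :> int)) | i <- enum 'I_d]).
rewrite /endpos big_flatten/= big_map [RHS]row_sum_delta big_enum/=.
apply: eq_bigr => i _; rewrite big_nseq iter_addr addr0.
rewrite /dir /=; case: (lerP 0 (x 0 i)) => xi; rewrite ?scale1r ?scaleN1r.
  by rewrite -scaler_nat natz gez0_abs.
by rewrite mulNrn -scaler_nat -scaleNr natz ltz0_abs// opprK.
Qed.

Section Potential.
Context (R : realType) (d : nat) (a : 'rV[int]_d -> 'I_d * bool -> R).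
Local Notation Zd := 'rV[int]_d.

Fixpoint path_sum (x : Zd) (s : seq ('I_d * bool)) : R :=
  if s is k :: s' then a x k + path_sum (x + dir k) s' else 0.

Lemma path_sumE x s : path_sum x s =
  \sum_(j < size s) a (x + pos s j) (tnth (in_tuple s) j).
Proof.
elim: s x => [|k s IH] x /=; first by rewrite big_ord0.
rewrite big_ord_recl /pos take0 big_nil addr0; congr (_ + _).
rewrite IH; apply: eq_bigr => j _; rewrite /pos /= big_cons addrA.
by congr (a _ _); rewrite !(tnth_nth k).
Qed.

Lemma path_sum_cat x s t : path_sum x (s ++ t) = path_sum x s + path_sum (x + endpos s) t.
Proof.
elim: s x => [|k s IH] x /=; first by rewrite /endpos big_nil addr0 add0r.
by rewrite IH /endpos big_cons !addrA.
Qed.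

(** Two paths from 0 with the same endpoint have equal sums, since one and the same return path
    closes both into loops. *)
Lemma potential : (forall x s, pos s (size s) = 0 -> path_sum x s = 0) ->
  exists W : Zd -> R, forall x k, W (x + dir k) - W x = a x k.
Proof.
move=> loop; have {}loop x s : endpos s = 0 -> path_sum x s = 0.
  by move=> s0; apply: loop; rewrite pos_size.
have [path pathE] := choice (@endpos_surj d).
pose W x := path_sum 0 (path x).
have WE s : path_sum 0 s = W (endpos s).
  have endD u v : endpos (u ++ v) = endpos u + endpos v :> Zd by rewrite /endpos big_cat.
  have back u : endpos u = endpos s ->
      path_sum 0 u = - path_sum (endpos s) (path (- endpos s)).
    move=> us; have e0 : endpos (u ++ path (- endpos s)) = 0.
      by rewrite endD pathE us subrr.
    have := loop 0 _ e0; rewrite path_sum_cat add0r us => /eqP.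
    by rewrite addr_eq0 => /eqP.
  by rewrite back// /W back// pathE.
exists W => x k; have := WE (path x ++ [:: k]).
rewrite path_sum_cat /endpos big_cat/= big_seq1 -/(endpos _) pathE add0r addr0.
by move=> <-; rewrite -/(W x) addrAC subrr add0r.
Qed.

End Potential.

Section ExpBound.
Context (R : realType) (d : nat).
Local Notation Zd := 'rV[int]_d.
Local Notation K := ('I_d * bool)%type.
Variables (pr : Zd -> K -> R).
Hypotheses (pr_ge0 : forall x k, 0 <= pr x k).

(** The expectation of [G (X_n)] for the walk started at [x]; a general starting point permits
    first-step recursion. *)
Definition path_exp (G : Zd -> R) n x : R :=
  \sum_(s : n.-tuple K)
    (\prod_(j < n) pr (x + pos s j) (tnth s j)) * G (x + pos s n).

Lemma path_exp0 G x : path_exp G 0 x = G x.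
Proof.
rewrite /path_exp (big_pred1 [tuple]) => [|s]; last by rewrite [s]tuple0/= eqxx.
by rewrite big_ord0 mul1r /pos big_nil addr0.
Qed.

Lemma path_expS G n x :
  path_exp G n.+1 x = \sum_k pr x k * path_exp G n (x + dir k).
Proof.
rewrite /path_exp.
under [RHS]eq_bigr do rewrite mulr_sumr.
rewrite pair_big/=.
rewrite (reindex (fun ks : K * n.-tuple K => cons_tuple ks.1 ks.2))/=; last first.
  exists (fun s : n.+1.-tuple K => (thead s, behead_tuple s)).
    by move=> [k s] _ /=; rewrite theadE; congr pair; apply: val_inj.
  by move=> s _ /=; rewrite [RHS]tuple_eta; apply: val_inj.
apply: eq_bigr => -[k s] _ /=.
have posS j : x + pos (k :: s) j.+1 = x + dir k + pos s j.
  by rewrite /pos /= big_cons addrA.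
have p0 : x + pos (k :: s) 0 = x by rewrite /pos big_nil addr0.
have t0 : tnth (cons_tuple k s) ord0 = k by rewrite (tnth_nth k).
rewrite big_ord_recl /= p0 t0 posS -mulrA; congr (_ * (_ * _)).
by apply: eq_bigr => j _; rewrite posS !(tnth_nth k).
Qed.

Lemma path_exp_le G H n x : (forall s : n.-tuple K, G (x + pos s n) <= H (x + pos s n)) ->
  path_exp G n x <= path_exp H n x.
Proof. by move=> GH; apply: ler_sum => s _; rewrite ler_wpM2l// prodr_ge0. Qed.

Lemma path_expZ c G n x : path_exp (fun z => c * G z) n x = c * path_exp G n x.
Proof. by rewrite /path_exp mulr_sumr; apply: eq_bigr => s _; rewrite mulrCA. Qed.

(** The supermartingale bound for [c^(-n) * G (X_n)], by induction on the first step. *)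
Lemma path_exp_supersolution G (c : R) n x : 0 <= c ->
  (forall x, \sum_k pr x k * G (x + dir k) <= c * G x) ->
  path_exp G n x <= c ^+ n * G x.
Proof.
move=> c0 Gc; elim: n x => [|n IH] x; first by rewrite path_exp0 mul1r.
rewrite path_expS exprSr -mulrA.
apply: le_trans (ler_wpM2l (exprn_ge0 n c0) (Gc x)).
rewrite mulr_sumr; apply: ler_sum => k _.
by rewrite mulrCA ler_wpM2l.
Qed.

Lemma path_exp_gt0 G n x : (forall x, \sum_k pr x k = 1) -> (forall x, 0 < G x) ->
  0 < path_exp G n x.
Proof.
move=> pr1 G0; elim: n x => [|n IH] x; first by rewrite path_exp0.
have /eqP : \sum_k pr x k != 0 by rewrite pr1 oner_eq0.
rewrite path_expS lt0r sumr_ge0 ?andbT; last first.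
  by move=> k _; rewrite mulr_ge0// ltW.
move=> nz; apply/eqP => /eqP; rewrite psumr_eq0; last first.
  by move=> k _; rewrite mulr_ge0// ltW.
move=> /allP H; apply: nz; apply: big1 => k _.
have := H k; rewrite mem_index_enum => /(_ isT)/=.
by rewrite mulf_eq0 (gt_eqF (IH _)) orbF => /eqP.
Qed.

Lemma pos_bound (s : seq K) n j : - n%:Z <= (pos s n : Zd) 0 j <= n%:Z.
Proof.
rewrite /pos summxE.
have : (`|\sum_(k <- take n s) dir k 0 j| <= (size (take n s))%:Z :> int).
  elim: (take n s) => [|k t IH] /=; first by rewrite big_nil normr0.
  rewrite big_cons (le_trans (ler_normD _ _))// -[(size t).+1]add1n PoszD lerD//.
  by rewrite /dir !mxE; case: k => i [] /=; case: eqP.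
have : (size (take n s) <= n)%N by rewrite size_take; case: ifP; lia.
rewrite -ler_norml => sn /le_trans; apply.
by rewrite lez_nat.
Qed.

End ExpBound.

Lemma limn_esup_le (R : realType) (u : (\bar R)^nat) (l : \bar R) n0 :
  (forall n, (n0 <= n)%N -> (u n <= l)%E) -> (limn_esup u <= l)%E.
Proof.
move=> ul; rewrite limn_esup_lim; apply: lime_le; first exact: is_cvg_esups.
exists n0 => // n /= n0n; apply: ge_ereal_sup => _ [k /= nk <-].
by apply: ul; exact: leq_trans nk.
Qed.

Section Quenched.
Context (R : realType) (dsp : measure_display) (Om : measurableType dsp)
  (P : probability Om R) (d : nat) (T Tinv : 'I_d -> Om -> Om)
  (p : Om -> 'I_d * bool -> R).
Hypotheses (d_gt0 : (0 < d)%N)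
  (TK : forall i, cancel (T i) (Tinv i) /\ cancel (Tinv i) (T i))
  (mT : forall i, measurable_fun setT (T i) /\ measurable_fun setT (Tinv i))
  (PT : forall i (A : set Om), measurable A ->
     P (T i @^-1` A) = P A /\ P (Tinv i @^-1` A) = P A)
  (TC : forall i j, T i \o T j = T j \o T i)
  (erg : forall A : set Om, measurable A -> (forall i, T i @^-1` A = A) ->
     P A = 0%E \/ P A = 1%E)
  (p01 : forall w k, 0 <= p w k <= 1)
  (p1 : forall w, \sum_k p w k = 1).
Local Notation Zd := 'rV[int]_d.
Local Notation S := (Defs.shift T Tinv).
Local Notation K := ('I_d * bool)%type.

Let p_ge0 w k : 0 <= p w k. Proof. by case/andP: (p01 w k). Qed.

Lemma ae_shift (Q : Om -> Prop) : {ae P, forall w, Q w} ->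
  {ae P, forall w, forall x, Q (S x w)}.
Proof.
move=> [N [mN PN QN]].
have aeS x : {ae P, forall w, Q (S x w)}.
  have [mS PS] := shift_pres mT PT x.
  exists (S x @^-1` N); split.
  - by rewrite -[X in measurable X]setTI; exact: mS.
  - by rewrite -PN; exact: PS.
  - by move=> w nQ; apply: QN.
have : {ae P, forall w, forall n : nat, forall x, unpickle n = Some x -> Q (S x w)}.
  apply/ae_foralln => n; case: (unpickle n) => [x|]; last exact: aeW.
  by apply: filterS (aeS x) => w Qx _ [<-].
by apply: filterS => w H x; apply: (H (pickle x)); exact: pickleK.
Qed.

Lemma dotZD (lam : 'rV[R]_d) x y : dotZ lam (x + y) = dotZ lam x + dotZ lam y.
Proof.
rewrite /dotZ -big_split/=; apply: eq_bigr => i _.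
by rewrite mxE intrD mulrDr.
Qed.

Lemma quenched_mgfE lam n w : quenched_mgf T Tinv p lam n w =
  path_exp (fun x => p (S x w)) (fun x => expR (dotZ lam x)) n 0.
Proof.
apply: eq_bigr => s _; rewrite add0r; congr (_ * _).
by apply: eq_bigr => j _; rewrite add0r.
Qed.

Lemma quenched_limsup_le (lam : 'rV[R]_d) (F : Om -> K -> R) (y : R) :
  classK P T Tinv F ->
  (ess_sup P (fun w => (ln (\sum_k p w k * expR (dotZ lam (dir k) + F w k)))%:E)
    < y%:E)%E ->
  {ae P, forall w,
    (limn_esup (fun n => ((n%:R)^-1 * ln (quenched_mgf T Tinv p lam n w))%:E) <= y%:E)%E}.
Proof.
move=> [[al al0 mF] F0 loopF] essF.
have q1 : 1 <= d%:R + al.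
  by rewrite (@le_trans _ _ d%:R)// ?ler1n// lerDl ltW.
have dq : d%:R < d%:R + al by rewrite ltrDl.
have ergS (A : set Om) : measurable A ->
    (forall i, Defs.shift T Tinv (unitv i) @^-1` A = A) -> P A = 0%E \/ P A = 1%E.
  move=> mA invA; apply: erg => // i; rewrite -[RHS](invA i).
  by apply/seteqP; split => w /=; rewrite shift_unitv.
have sublin := cocycle_sublinear (shift0 T Tinv) (shiftD TK TC)
  (fun x => (shift_pres mT PT x).1) (fun x => (shift_pres mT PT x).2)
  ergS q1 dq (fun i => (mF (i, true)).1) (fun i => (mF (i, true)).2) (fun i => F0 (i, true)).
pose V w := \sum_k p w k * expR (dotZ lam (dir k) + F w k).
(* [ln] is total, so a bound on [ln (V w)] can be exponentiated only for positive [V w]. *)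
have V_gt0 w : 0 < V w.
  rewrite lt0r sumr_ge0 ?andbT; last by move=> k _; rewrite mulr_ge0 ?expR_ge0.
  apply/negP => /eqP V0; have := p1 w; rewrite big1 => [/esym/eqP|k _].
    by rewrite oner_eq0.
  move/eqP: V0; rewrite psumr_eq0 => [/allP H|j _]; last by rewrite mulr_ge0 ?expR_ge0.
  have := H k; rewrite mem_index_enum => /(_ isT)/=.
  by rewrite mulf_eq0 (gt_eqF (expR_gt0 _)) orbF => /eqP.
have aeV : {ae P, forall w, V w <= expR y}.
  apply: filterS (ess_sup_ge P (fun w => (ln (V w))%:E)) => w /= Vw.
  by rewrite -[leLHS]lnK ?posrE// ler_expR -lee_fin (le_trans Vw)// ltW.
have {}aeV := ae_shift aeV.
apply: filterS3 sublin loopF aeV => w sub loop Vw.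
have [W WF] : exists W : Zd -> R, forall x k, W (x + dir k) - W x = F (S x w) k.
  apply: (@potential _ _ (fun x => F (S x w))) => x s s0.
  by rewrite path_sumE; exact: loop.
have gW (x : Zd) i : W (x + unitv i) - W x = F (S x w) (i, true).
  by rewrite -dir_true WF.
have {}sub := sub W gW.
apply/lee_addgt0Pr => e e0; have e20 : 0 < e / 2 by rewrite divr_gt0.
have [k0 Hk0] := sub _ e20.
apply: (@limn_esup_le _ _ _ (2 ^ k0.+1)) => n nk0; rewrite -EFinD lee_fin.
have n0 : (0 < n)%N by apply: leq_trans nk0; rewrite expn_gt0.
(* After [n] steps the walk is in the box of scale [2 ^ k.+1 <= 2 * n], so the tolerance [e / 2]
   costs at most [e * n]. *)
pose k := trunc_log 2 n.
have /andP[kn nk] : (2 ^ k <= n < 2 ^ k.+1)%N by exact: trunc_log_bounds.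
have k0k : (k0 <= k.+1)%N.
  by rewrite -(@leq_exp2l 2)// ltnW// (leq_ltn_trans _ nk)// (leq_trans _ nk0)// leq_exp2l.
set G := fun x => expR (dotZ lam x + W x).
have mgf_le : quenched_mgf T Tinv p lam n w <= expR (e / 2 * (2 ^ k.+1)%:R) * expR y ^+ n.
  rewrite quenched_mgfE.
  apply: (@le_trans _ _ (path_exp (fun x => p (S x w))
    (fun x => expR (e / 2 * (2 ^ k.+1)%:R - W 0) * G x) n 0)).
    apply: path_exp_le => [x j|s]; first exact: p_ge0.
    rewrite add0r -expRD ler_expR.
    have /(Hk0 k.+1 k0k) : forall j, - (2 ^ k.+1)%:Z <= (pos s n : Zd) 0 j <= (2 ^ k.+1)%:Z.
      by move=> j; have := pos_bound s n j; lia.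
    by rewrite ler_norml; lra.
  rewrite path_expZ.
  have := @path_exp_supersolution R d (fun x => p (S x w)) (fun _ _ => p_ge0 _ _) G (expR y) n 0 (expR_ge0 _).
  (* As [F (S x w)] is the increment of [W], the left side is [V (S x w) * G x], and [V <= expR y]
     along the whole orbit. *)
  have GV x : \sum_k p (S x w) k * G (x + dir k) <= expR y * G x.
    apply: le_trans (ler_wpM2r (expR_ge0 _) (Vw x)).
    rewrite /V mulr_suml; apply: ler_sum => j _; rewrite -mulrA -expRD.
    rewrite /G dotZD -(WF x j) ler_wpM2l// ler_expR; lra.
  move=> /(_ GV) H; apply: le_trans (ler_wpM2l (expR_ge0 _) H) _.
  have -> : G 0 = expR (W 0) by rewrite /G /dotZ big1 ?add0r// => i _; rewrite mxE mulr0.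
  by rewrite mulrCA -expRD subrK mulrC.
have mgf_gt0 : 0 < quenched_mgf T Tinv p lam n w.
  rewrite quenched_mgfE; apply: path_exp_gt0 => *; [exact: p_ge0|exact: p1|exact: expR_gt0].
have nR : 0 < n%:R :> R by rewrite ltr0n.
rewrite mulrC ler_pdivrMr//.
rewrite -expRM_natl -expRD in mgf_le.
rewrite -ler_expR lnK ?posrE//; apply: le_trans mgf_le _; rewrite ler_expR.
have : (2 ^ k.+1)%:R <= 2 * n%:R :> R by rewrite -natrM ler_nat expnS leq_mul2l.
move=> h; have := ler_wpM2l (ltW e20) h.
rewrite mulr_natl; lra.
Qed.

End Quenched.

Theorem theorem3p3 (R : realType) (dsp : measure_display) (Om : measurableType dsp)
  (P : probability Om R) (d : nat) (T Tinv : 'I_d -> Om -> Om)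
  (p : Om -> 'I_d * bool -> R) :
  (0 < d)%N ->
  (forall i, cancel (T i) (Tinv i) /\ cancel (Tinv i) (T i)) ->
  (forall i, measurable_fun setT (T i) /\ measurable_fun setT (Tinv i)) ->
  (forall i (A : set Om), measurable A ->
     P (T i @^-1` A) = P A /\ P (Tinv i @^-1` A) = P A) ->
  (forall i j, T i \o T j = T j \o T i) ->
  (forall A : set Om, measurable A -> (forall i, T i @^-1` A = A) ->
     P A = 0%E \/ P A = 1%E) ->
  (forall k, measurable_fun setT (fun w => p w k)) ->
  (forall w k, 0 <= p w k <= 1) ->
  (forall w, \sum_k p w k = 1) ->
  forall lam : 'rV[R]_d,
  {ae P, forall w,
     (limn_esup (fun n => ((n%:R)^-1 * ln (quenched_mgf T Tinv p lam n w))%:E)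
       <= Lambda P T Tinv p lam)%E}.
Proof.
move=> d0 TK mT PT TC erg _ p01 p1 lam.
have above (y : R) : (Lambda P T Tinv p lam < y%:E)%E -> {ae P, forall w,
    (limn_esup (fun n => ((n%:R)^-1 * ln (quenched_mgf T Tinv p lam n w))%:E) <= y%:E)%E}.
  by move=> /ereal_inf_lt[_ [F KF <-] Fy]; exact: quenched_limsup_le KF Fy.
(* A countable sequence of values [y] decreasing to [Lambda] keeps the union of the exceptional sets
   null. *)
case: (Lambda P T Tinv p lam) above => [l| |] above.
- have : {ae P, forall w, forall n : nat,
    (limn_esup (fun n => ((n%:R)^-1 * ln (quenched_mgf T Tinv p lam n w))%:E)
      <= (l + n.+1%:R^-1)%:E)%E}.
    by apply/ae_foralln => n; apply: above; rewrite lte_fin ltrDl invr_gt0.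
  apply: filterS => w H; apply/lee_addgt0Pr => e e0.
  apply: le_trans (H (Num.truncn e^-1)) _; rewrite -EFinD lee_fin lerD2l.
  by rewrite invf_ple ?posrE// ltW// truncnS_gt.
- by apply: aeW => w; rewrite leey.
- have : {ae P, forall w, forall n : nat,
    (limn_esup (fun n => ((n%:R)^-1 * ln (quenched_mgf T Tinv p lam n w))%:E)
      <= (- n%:R)%:E)%E}.
    by apply/ae_foralln => n; apply: above; rewrite ltNyr.
  apply: filterS => w; case: (limn_esup _) => [x| |] H; last exact: lexx.
    have := H (Num.truncn (- x)).+1; rewrite lee_fin lerNr leNgt.
    by rewrite truncnS_gt.
  by have := H 0; rewrite leye_eq.
Qed.
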